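(* Let $(\mathbf{X}_1,Y_1),(\mathbf{X}_2,Y_2),\dots$ be a random sample (i.i.d. copies) from a $(d+1)$-dimensional random vector $(\mathbf{X},Y)$ with continuous univariate marginal distribution functions and connecting copula $A\in\mathcal{C}^{d+1}$. Then, for all $(s,t)\in[0,1]^2$, $$\lim_{n\to\infty}D_n(s,t)=\psi(A)(s,t)\quad\text{almost surely},$$ where $$D_n(s,t)=\frac1n\sum_{k=1}^n\mathbf{1}_{[0,s]}\big(G_n^\ast(Y_k)\big)\,\mathbf{1}_{[0,t]}\big(G_n^\ast(Y_{N(k)})\big),\qquad G_n^\ast(y)=\frac1{n+1}\sum_{k=1}^n\mathbf{1}_{(-\infty,y]}(Y_k).$$
   Context: Let $\mathbb{I}=[0,1]$ and $d\ge 1$ an integer. $\mathcal{C}^{k}$ is the family of all $k$-dimensional copulas. For $A\in\mathcal{C}^{d+1}$, $\mu_A$ denotes the probability measure on $\mathbb{I}^{d+1}$ with distribution function $A$; $A^{1:d}$ is the marginal of $A$ with respect to the first $d$ coordinates (for $d=1$, $\mu_{A^{1:d}}$ is Lebesgue measure on $\mathbb{I}$); $K_A:\mathbb{I}^d\times\mathcal{B}(\mathbb{I})\to\mathbb{I}$ is (a version of) the Markov kernel of $A$, i.e. the regular conditional distribution of the last coordinate given the first $d$ coordinates. The map $\psi:\mathcal{C}^{d+1}\to\mathcal{C}^2$ is defined by $$\psi(A)(s,t)=\int_{\mathbb{I}^d}K_A(\mathbf{u},[0,s])\,K_A(\mathbf{u},[0,t])\,\mathrm{d}\mu_{A^{1:d}}(\mathbf{u}),\qquad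 (s,t)\in\mathbb{I}^2.$$ The connecting copula of $(\mathbf{X},Y)$ is the distribution function of $(F_1(X_1),\dots,F_d(X_d),G(Y))$ with $F_i$, $G$ the marginal distribution functions. For a sample of size $n\ge 2$ and $i\in\{1,\dots,n\}$, $N(i)$ (which depends on $n$) is the index $j\in\{1,\dots,n\}\setminus\{i\}$ such that $\mathbf{X}_j$ is the nearest neighbour of $\mathbf{X}_i$ among $\mathbf{X}_1,\dots,\mathbf{X}_n$ with respect to the Euclidean metric on $\mathbb{R}^d$; if there are several nearest neighbours, ties are broken at random (using i.i.d. uniform random variables on $[0,1]$, one for each $i$, independent of the sample). *)

(* Defs.v *)
From HB Require Import structures.
From mathcomp Require Import all_boot all_order all_algebra.
From mathcomp Require Import finmap.
From mathcomp Require Import all_classical all_reals all_analysis.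

Set Implicit Arguments.
Unset Strict Implicit.
Unset Printing Implicit Defensive.

Import Order.TTheory GRing.Theory Num.Theory.
Import numFieldNormedType.Exports.

Local Open Scope classical_set_scope.
Local Open Scope ring_scope.

(* Points of R^k are k-tuples; the sigma-algebra on [k.-tuple R] is the one
   generated by the coordinates, i.e. the Borel sigma-algebra of R^k. *)

Section coordinates.
Context {R : realType} {k : nat}.

Definition coord (i : 'I_k) (x : k.-tuple R) : R := tnth x i.

Lemma measurable_coord i : measurable_fun [set: k.-tuple R] (coord i).
Proof. exact: measurable_tnth. Qed.

HB.instance Definition _ i :=
  isMeasurableFun.Build _ _ _ _ (coord i) (measurable_coord i).

Definition unit_cube : set (k.-tuple R) :=
  [set u | forall i, coord i u \in `[0, 1]].

Definition lower_orthant (u : k.-tuple R) : set (k.-tuple R) :=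
  [set x | forall i, coord i x <= coord i u].

Definition edist (x y : k.-tuple R) : R :=
  Num.sqrt (\sum_(i < k) (coord i x - coord i y) ^+ 2).

End coordinates.

Section init_last.
Context {R : realType} {d : nat}.

Definition init_coords (z : d.+1.-tuple R) : d.-tuple R :=
  [tuple coord (widen_ord (leqnSn d) i) z | i < d].

Definition last_coord (z : d.+1.-tuple R) : R := coord ord_max z.

Lemma measurable_init_coords :
  measurable_fun [set: d.+1.-tuple R] init_coords.
Proof.
apply/measurable_fun_tnthP => i.
rewrite (_ : _ \o _ = coord (widen_ord (leqnSn d) i)).
  exact: measurable_coord.
by apply/funext => z /=; rewrite tnth_mktuple.
Qed.

HB.instance Definition _ :=
  isMeasurableFun.Build _ _ _ _ init_coords measurable_init_coords.

End init_last.

(* A k-dimensional copula A: the restriction to [0,1]^k of the distribution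
   function of a (necessarily unique) probability measure mu_A with uniform
   univariate margins, which is therefore carried by [0,1]^k.  The values of
   [copula_fun] outside the cube are irrelevant. *)
Record copula (R : realType) (k : nat) := Copula {
  copula_fun :> k.-tuple R -> R ;
  copula_measure : probability (k.-tuple R) R ;
  copula_margins : forall (i : 'I_k) (B : set R), measurable B ->
    distribution copula_measure (coord i) B = uniform_prob (@ltr01 R) B ;
  copula_cdf : forall u, unit_cube u ->
    copula_measure (lower_orthant u) = (copula_fun u)%:E }.

Section markov_kernel_psi.
Context {R : realType} {d : nat} (A : copula R d.+1).

(* mu_{A^{1:d}} *)
Definition init_margin : probability (d.-tuple R) R :=
  distribution (copula_measure A) init_coords.

(* [K] is a version of the regular conditional distribution of the last
   coordinate given the first [d] ones under mu_A. *)
Definition is_markov_kernel (K : R.-pker (d.-tuple R) ~> R) : Prop :=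
  forall (E : set (d.-tuple R)) (F : set R), measurable E -> measurable F ->
    copula_measure A (init_coords @^-1` E `&` last_coord @^-1` F) =
    (\int[init_margin]_(u in E) K u F)%E.

Definition psi (K : R.-pker (d.-tuple R) ~> R) (s t : R) : R :=
  \int[init_margin]_(u in unit_cube)
    (fine (K u [set` `[0, s]]) * fine (K u [set` `[0, t]])).

End markov_kernel_psi.

Section independence.
Context {disp : measure_display} {Omega : measurableType disp} {R : realType}.
Variable P : probability Omega R.

Definition independent_family {d' : measure_display} {T : measurableType d'}
    (X : nat -> {RV P >-> T}) : Prop :=
  forall (J : {fset nat}) (B : nat -> set T),
    (forall j, measurable (B j)) ->
    P (\bigcap_(j in [set` J]) X j @^-1` B j) =
    (\prod_(j <- J) P (X j @^-1` B j))%E.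

Definition identically_distributed {d' : measure_display}
    {T : measurableType d'} (X : nat -> {RV P >-> T}) : Prop :=
  forall (j : nat) (B : set T), measurable B ->
    distribution P (X j) B = distribution P (X 0%N) B.

Definition iid {d' : measure_display} {T : measurableType d'}
    (X : nat -> {RV P >-> T}) : Prop :=
  independent_family X /\ identically_distributed X.

Definition sigma_process {d' : measure_display} {T : measurableType d'}
    (X : nat -> {RV P >-> T}) : set (set Omega) :=
  <<s \bigcup_j preimage_set_system setT (X j) measurable >>.

Definition independent_processes {d1 d2 : measure_display}
    {T1 : measurableType d1} {T2 : measurableType d2}
    (X : nat -> {RV P >-> T1}) (Y : nat -> {RV P >-> T2}) : Prop :=
  forall E F : set Omega, sigma_process X E -> sigma_process Y F ->
    P (E `&` F) = (P E * P F)%E.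

End independence.

Section random_vector.
Context {disp : measure_display} {Omega : measurableType disp} {R : realType}.
Context {P : probability Omega R} {k : nat}.
Variable Z : {RV P >-> k.-tuple R}.

Definition margin_cdf (i : 'I_k) (x : R) : R :=
  fine (cdf (coord i \o Z : {RV P >-> R}) x).

Definition connecting_copula (A : copula R k) : Prop :=
  forall u, unit_cube u ->
    A u = fine (P [set w | forall i : 'I_k,
                    margin_cdf i (coord i (Z w)) <= coord i u]).

End random_vector.

Section nearest_neighbour.
Context {R : realType} {d n : nat}.
Variables (x : 'I_n -> d.-tuple R) (u : 'I_n -> R).

Definition nearest_neighbours (i : 'I_n) : {set 'I_n} :=
  [set j | (j != i) &&
    [forall l, (l != i) ==> (edist (x i) (x j) <= edist (x i) (x l))]].

(* Ties are broken by [u i] in [0,1]: among the [m] nearest neighbours of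
   [x i], listed by increasing index, the one in position [floor (m * u i)] is
   chosen (the last one if [u i = 1]), so that a uniform [u i] picks each of
   them with probability [1 / m].  For n <= 1 there is no candidate and the
   value is the dummy [i]. *)
Definition nearest_neighbour (i : 'I_n) : 'I_n :=
  let s := enum (nearest_neighbours i) in
  nth i s (minn (Num.truncn ((size s)%:R * u i)) (size s).-1).

End nearest_neighbour.

Section estimator.
Context {R : realType} {d : nat}.

(* (n+1)^-1 * #{k < n | y_k <= y} *)
Definition scaled_ecdf (n : nat) (Y : 'I_n -> R) (y : R) : R :=
  n.+1%:R^-1 * \sum_(k < n) \1_[set` `]-oo, y]] (Y k).

Definition D_stat (z : nat -> d.+1.-tuple R) (u : nat -> R) (n : nat)
    (s t : R) : R :=
  let Y (k : 'I_n) := last_coord (z k) in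
  let N := nearest_neighbour (fun k : 'I_n => init_coords (z k))
                             (fun k : 'I_n => u k) in
  n%:R^-1 * \sum_(k < n) (\1_[set` `[0, s]] (scaled_ecdf Y (Y k)) *
                          \1_[set` `[0, t]] (scaled_ecdf Y (Y (N k)))).

End estimator.

(* Main.v *)
(* Put [f = 1{G(Y) <= s}], [g = 1{G(Y) <= t}], [h(x) = P(G(Y) <= t | X = x)].

   - Empirical ranks may be replaced by the true margin: both indicators pick a
     lower set of the responses, so the number of indices where they differ is
     the difference of two cardinalities, and a point of the sample is the
     nearest neighbour of at most [kissing_bound d] others (two such points are
     seen from it under an angle of at least 60 degrees).
   - [1/n sum_k f_k (g_N(k) - h(X_N(k)))] tends to 0: given the [X_i] and the
     tie-breaking variables the noise is independent and centred, hence the sum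
     has second moment O(n); adding one observation changes it by O(1), so
     convergence along squares is enough.
   - [1/n sum_k |h(X_N(k)) - h(X_k)|] tends to 0: the sets [B] for which this
     holds with [h = 1_B] form a sigma-algebra, which contains the half-spaces
     because all but o(n) points are close to their nearest neighbour.
   - [1/n sum_k f_k h(X_k)] tends to [psi A s t] by the strong law. *)

Require Import Defs.
From mathcomp Require Import all_boot all_order all_algebra.
From HB Require Import structures.
From mathcomp Require Import finmap.
From mathcomp Require Import all_classical all_reals all_analysis.
From mathcomp Require Import measurable_realfun.
From mathcomp Require Import ring lra zify.
Import Order.TTheory GRing.Theory Num.Theory.
Import numFieldNormedType.Exports.
(* [coord] is also a name of [vector]. *)
Import Defs.

Set Implicit Arguments.
Unset Strict Implicit.
Unset Printing Implicit Defensive.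

Local Open Scope classical_set_scope.
Local Open Scope ring_scope.

(** * Expectations of bounded measurable functions *)

(** The estimator reads a response at a random index that depends on the whole sample, and [h] is
    only measurable, so nearness of [X_N(k)] to [X_k] says nothing about [h] directly. For the
    noise, conditioning is expressed through a pi-system: [pi_sets] describes all the data except
    one response, and neighbour indices are measurable for the sigma-algebra it generates. Since
    [f_k] involves the response of [k], a pair of summands [k], [l] is centred only if [N(k)] is
    neither [l] nor [N(l)]; the remaining pairs number O(n). For the stability, the kissing bound is
    what lets countable unions pass: a set hit by few sample points is hit by few of their
    neighbours. This bound breaks down for repeated points, so the sample is first shown to be
    almost surely free of ties. Distances live on the original scale but the kernel of [A] on the
    copula scale; as marginal distribution functions may be flat, the two scales are identified up
    to null sets only. *)

Lemma indic_in (T : Type) (R : pzRingType) (A : set T) x : A x -> \1_A x = 1 :> R.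
Proof. by move=> Ax; rewrite indicE mem_set. Qed.

Lemma indic_notin (T : Type) (R : pzRingType) (A : set T) x :
  ~ A x -> \1_A x = 0 :> R.
Proof. by move=> Ax; rewrite indicE memNset. Qed.

Section bounded_measurable.
Context d (T : measurableType d) (R : realType).
Implicit Types (f g : T -> R) (A B : set T).

Definition bmf f := measurable_fun setT f /\ exists M : R, forall x, `|f x| <= M.

Lemma bmf_measurable f : bmf f -> measurable_fun setT f.
Proof. by case. Qed.

Lemma bmf_cst c : bmf (fun _ => c).
Proof. by split; [exact: measurable_cst|exists `|c|]. Qed.

Lemma bmfD f g : bmf f -> bmf g -> bmf (fun x => f x + g x).
Proof.
move=> [mf [M fM]] [mg [N gN]]; split; first exact: measurable_funD.
exists (M + N) => x; rewrite (le_trans (ler_normD _ _))// lerD//.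
Qed.

Lemma bmfM f g : bmf f -> bmf g -> bmf (fun x => f x * g x).
Proof.
move=> [mf [M fM]] [mg [N gN]]; split; first exact: measurable_funM.
by exists (M * N) => x; rewrite normrM ler_pM.
Qed.

Lemma bmfB f g : bmf f -> bmf g -> bmf (fun x => f x - g x).
Proof.
move=> [mf [M fM]] [mg [N gN]]; split; first exact: measurable_funB.
exists (M + N) => x; rewrite (le_trans (ler_normB _ _))// lerD//.
Qed.

Lemma bmf_indic A : measurable A -> bmf (\1_A : T -> R).
Proof.
move=> mA; split; first exact: measurable_indic.
by exists 1 => x; rewrite indicE; case: (_ \in _); rewrite ?normr1 ?normr0.
Qed.

Lemma bmf_sum I (s : seq I) (F : I -> T -> R) :
  (forall i, bmf (F i)) -> bmf (fun x => \sum_(i <- s) F i x).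
Proof.
move=> bF; elim: s => [|i s IH].
  rewrite (_ : (fun _ => _) = fun _ => 0); first exact: bmf_cst.
  by apply/funext => x; rewrite big_nil.
rewrite (_ : (fun _ => _) = fun x => F i x + \sum_(j <- s) F j x).
  exact: bmfD.
by apply/funext => x; rewrite big_cons.
Qed.

Lemma bmf01 f : measurable_fun setT f -> (forall x, 0 <= f x <= 1) -> bmf f.
Proof.
move=> mf f01; split => //; exists 1 => x.
by have /andP[f0 f1] := f01 x; rewrite ger0_norm.
Qed.

End bounded_measurable.

Lemma bmf_comp d d' (T : measurableType d) (T' : measurableType d')
    (R : realType) (f : T' -> R) (X : T -> T') :
  bmf f -> measurable_fun setT X -> bmf (fun x => f (X x)).
Proof.
move=> [mf [M fM]] mX; split; first exact: (measurableT_comp mf mX).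
by exists M.
Qed.

Section expectation.
Context d (T : measurableType d) (R : realType) (P : probability T R).
Implicit Types (f g : T -> R) (A B : set T).

Definition Ex f : R := \int[P]_x f x.

Lemma bmf_integrable f : bmf f -> P.-integrable setT (EFin \o f).
Proof.
move=> [mf [M fM]]; apply: measurable_bounded_integrable => //.
  by rewrite -ge0_fin_numE// fin_num_measure.
exists M; split; first exact: num_real.
by move=> r Mr x _; apply: (le_trans (fM x)); exact: ltW.
Qed.

Lemma ExD f g : bmf f -> bmf g -> Ex (fun x => f x + g x) = Ex f + Ex g.
Proof. by move=> bf bg; apply: RintegralD => //; exact: bmf_integrable. Qed.

Lemma ExB f g : bmf f -> bmf g -> Ex (fun x => f x - g x) = Ex f - Ex g.
Proof. by move=> bf bg; apply: RintegralB => //; exact: bmf_integrable. Qed.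

Lemma ExZ f c : bmf f -> Ex (fun x => c * f x) = c * Ex f.
Proof. by move=> bf; apply: RintegralZl => //; exact: bmf_integrable. Qed.

Lemma Ex_cst c : Ex (fun _ => c) = c.
Proof. by rewrite /Ex /Rintegral integral_cst//= probability_setT mule1. Qed.

Lemma Ex_indic A : measurable A -> Ex \1_A = fine (P A).
Proof. by move=> mA; rewrite /Ex /Rintegral integral_indic// setIT. Qed.

Lemma Ex_sum I (s : seq I) (F : I -> T -> R) : (forall i, bmf (F i)) ->
  Ex (fun x => \sum_(i <- s) F i x) = \sum_(i <- s) Ex (F i).
Proof.
move=> bF; elim: s => [|i s IH].
  rewrite big_nil (_ : (fun _ => _) = fun _ => 0) ?Ex_cst//.
  by apply/funext => x; rewrite big_nil.
rewrite big_cons -IH -ExD//; last exact: bmf_sum.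
by congr Ex; apply/funext => x; rewrite big_cons.
Qed.

Lemma le_Ex f g : bmf f -> bmf g -> (forall x, f x <= g x) -> Ex f <= Ex g.
Proof. by move=> bf bg fg; apply: le_Rintegral => //; exact: bmf_integrable. Qed.

Lemma Ex_ge0 f : (forall x, 0 <= f x) -> 0 <= Ex f.
Proof. by move=> f0; apply: Rintegral_ge0. Qed.

Lemma norm_Ex_le f M : bmf f -> (forall x, `|f x| <= M) -> `|Ex f| <= M.
Proof.
move=> bf fM; rewrite ler_norml -{1}(Ex_cst (- M)) -{2}(Ex_cst M).
by apply/andP; split; apply: le_Ex => //; try exact: bmf_cst;
  move=> x; have := fM x; rewrite ler_norml => /andP[].
Qed.

Lemma Ex_ae_eq f g : measurable_fun setT f -> measurable_fun setT g ->
  {ae P, forall x, f x = g x} -> Ex f = Ex g.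
Proof.
move=> mf mg fg; congr fine; apply: ae_eq_integral => //.
- exact/measurable_EFinP.
- exact/measurable_EFinP.
- by move: fg; apply: filterS => x /= -> _.
Qed.

Lemma le_Ex_ae f g : bmf f -> bmf g -> {ae P, forall x, f x <= g x} ->
  Ex f <= Ex g.
Proof.
move=> bf bg fg; have [mf _] := bf; have [mg _] := bg.
have bgf : bmf (fun x => g x - f x) by exact: bmfB.
have [mgf [M gfM]] := bgf.
have mm : measurable_fun setT (fun x => Num.max (g x - f x) 0).
  exact: measurable_maxr.
(* The positive part equals [g - f] off a null set and is nonnegative everywhere. *)
rewrite -subr_ge0 -ExB// (@Ex_ae_eq _ (fun x => Num.max (g x - f x) 0))//.
  by apply: Ex_ge0 => x; rewrite le_max lexx orbT.
by move: fg; apply: filterS => x /= fg; apply/esym/max_idPl; rewrite subr_ge0.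
Qed.

End expectation.

(** * From indicators to bounded functions *)

Section level_approximation.
Context d (T : measurableType d) (R : realType).
Variables (phi : T -> R) (mphi : measurable_fun setT phi).
Hypothesis phi01 : forall x, 0 <= phi x <= 1.

Definition level_set q (a : nat) : set T := [set x | a.+1%:R / q%:R <= phi x].

(** Of the thresholds [1/q, ..., q/q] exactly [floor (q * phi x)] are reached, so this is [phi]
    rounded down to a multiple of [1/q], written as a combination of indicators. *)
Definition level_approx q x : R := \sum_(a < q) q%:R^-1 * \1_(level_set q a) x.

Lemma measurable_level_set q a : measurable (level_set q a).
Proof.
rewrite /level_set (_ : [set _ | _] = phi @^-1` `[a.+1%:R / q%:R, +oo[); last first.
  by apply/seteqP; split => x /=; rewrite in_itv/= andbT.
by rewrite -[X in measurable X]setTI; apply: mphi.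
Qed.

Lemma level_approxP q x : (0 < q)%N -> `|phi x - level_approx q x| <= q%:R^-1.
Proof.
move=> q0; have /andP[p0 p1] := phi01 x.
have q0' : 0 < q%:R :> R by rewrite ltr0n.
have y0 : 0 <= q%:R * phi x by rewrite mulr_ge0// ltW.
pose m := Num.truncn (q%:R * phi x).
have /andP[m1 m2] : m%:R <= q%:R * phi x < m.+1%:R by exact: truncn_itv.
have mq : (m <= q)%N.
  by rewrite -(ler_nat R) (le_trans m1)// ler_piMr// ltW.
have -> : level_approx q x = m%:R / q%:R.
  rewrite /level_approx -mulr_sumr mulrC; congr (_ * _).
  under eq_bigr => a _ do rewrite indicE.
  rewrite -natr_sum; congr (_%:R).
  have E (a : 'I_q) : (x \in level_set q a) = (a < m)%N.
    rewrite /level_set; apply/idP/idP.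
      rewrite inE /= ler_pdivrMr// mulrC => h.
      by rewrite -ltnS -(ltr_nat R) (le_lt_trans h).
    move=> am; rewrite inE /= ler_pdivrMr// mulrC (le_trans _ m1)//.
    by rewrite ler_nat.
  under eq_bigr => a _ do rewrite E.
  rewrite -(big_mkord xpredT (fun a => nat_of_bool (a < m)%N)).
  rewrite (big_cat_nat _ (n := m))//= big_nat_cond.
  rewrite (eq_bigr (fun=> 1%N)); last by move=> i; rewrite andbT => /andP[_ ->].
  rewrite -big_nat_cond sum_nat_const_nat subn0 muln1.
  rewrite big_nat_cond big1 ?addn0// => i; rewrite andbT => /andP[mi _].
  by rewrite ltnNge mi.
have -> : phi x - m%:R / q%:R = (q%:R * phi x - m%:R) / q%:R.
  by rewrite mulrBl mulrAC divff ?mul1r// gt_eqF.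
rewrite normrM [X in _ * X]ger0_norm; last by rewrite invr_ge0 ltW.
rewrite ler_piMl ?invr_ge0 ?(ltW q0')// ger0_norm ?subr_ge0//.
by rewrite lerBlDl -natr1 in m2 *; rewrite ltW.
Qed.

End level_approximation.

Section agree_on_sets.
Context d (T : measurableType d) (R : realType).
Context d1 (T1 : measurableType d1) (P1 : probability T1 R).
Context d2 (T2 : measurableType d2) (P2 : probability T2 R).
Variables (X1 : T1 -> T) (X2 : T2 -> T) (a1 : T1 -> R) (a2 : T2 -> R).
Hypotheses (mX1 : measurable_fun setT X1) (mX2 : measurable_fun setT X2).
Hypotheses (ba1 : bmf a1) (ba2 : bmf a2).
Hypothesis agree : forall E, measurable E ->
  Ex P1 (fun x => \1_E (X1 x) * a1 x) = Ex P2 (fun x => \1_E (X2 x) * a2 x).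

(** Both sides are linear in [phi], and each moves by at most a multiple of [1/q] when [phi] is
    replaced by [level_approx], where they agree by hypothesis. Allowing two spaces and two weights
    lets one lemma serve for image laws, independence and disintegration. *)
Lemma Ex_agree (phi : T -> R) : measurable_fun setT phi -> (forall x, 0 <= phi x <= 1) ->
  Ex P1 (fun x => phi (X1 x) * a1 x) = Ex P2 (fun x => phi (X2 x) * a2 x).
Proof.
move=> mphi phi01; have bphi := bmf01 mphi phi01.
have aux d' (T' : measurableType d') (P' : probability T' R) (X : T' -> T) a :
    measurable_fun setT X -> bmf a -> exists2 M : R, 0 <= M & forall q, (0 < q)%N ->
    `|Ex P' (fun x => phi (X x) * a x) -
      q%:R^-1 * \sum_(i < q) Ex P' (fun x => \1_(level_set phi q i) (X x) * a x)|
      <= M / q%:R.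
  move=> mX ba; have [_ [M aM]] := ba; exists M.
    by rewrite (le_trans _ (aM point)).
  move=> q q0.
  have bl i : bmf (fun x => \1_(level_set phi q i) (X x) * a x).
    apply: bmfM => //; apply: (@bmf_comp _ _ _ _ _ _ X) => //.
    by apply: bmf_indic; exact: measurable_level_set.
  have bp : bmf (fun x => phi (X x) * a x).
    by apply: bmfM => //; exact: bmf_comp.
  have bl' (i : 'I_q) : bmf (fun x => \1_(level_set phi q i) (X x) * a x) by [].
  rewrite -(Ex_sum P' (index_enum _) bl') -ExZ; last exact: bmf_sum.
  rewrite -ExB//; last by apply: bmfM; [exact: bmf_cst|exact: bmf_sum].
  apply: norm_Ex_le => [|x].
    by apply: bmfB => //; apply: bmfM; [exact: bmf_cst|exact: bmf_sum].
  rewrite -mulr_suml mulrA mulr_sumr -/(level_approx phi q (X x)) -mulrBl.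
  by rewrite normrM mulrC ler_pM// level_approxP.
have [M1 M10 h1] := aux _ _ P1 _ _ mX1 ba1.
have [M2 M20 h2] := aux _ _ P2 _ _ mX2 ba2.
apply/eqP; rewrite -subr_eq0 -normr_le0; apply/ler_addgt0Pr => e e0; rewrite add0r.
pose q := (Num.truncn ((M1 + M2) / e)).+1.
have q0 : (0 < q)%N by [].
have := lerD (h1 q q0) (h2 q q0); rewrite -mulrDl.
rewrite (eq_bigr _ (fun (i : 'I_q) _ => agree (measurable_level_set mphi q i))).
set S := _ * _ => /(le_trans _) le1.
have : `|Ex P1 (fun x => phi (X1 x) * a1 x) - Ex P2 (fun x => phi (X2 x) * a2 x)|
   <= (M1 + M2) / q%:R.
  by apply: le1; rewrite (le_trans (ler_distD S _ _))// lerD2l distrC.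
move=> /le_trans; apply.
rewrite ler_pdivrMr ?ltr0n// mulrC -ler_pdivrMr//.
exact/ltW/truncnS_gt.
Qed.

End agree_on_sets.

Lemma Ex_same_law d1 d2 d (T1 : measurableType d1) (T2 : measurableType d2)
    (T : measurableType d) (R : realType) (P1 : probability T1 R)
    (P2 : probability T2 R) (X1 : T1 -> T) (X2 : T2 -> T) (phi : T -> R) :
  measurable_fun setT X1 -> measurable_fun setT X2 ->
  (forall E, measurable E -> P1 (X1 @^-1` E) = P2 (X2 @^-1` E)) ->
  measurable_fun setT phi -> (forall x, 0 <= phi x <= 1) ->
  Ex P1 (fun w => phi (X1 w)) = Ex P2 (fun w => phi (X2 w)).
Proof.
move=> mX1 mX2 law mphi phi01.
transitivity (Ex P1 (fun w => phi (X1 w) * 1)).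
  by congr Ex; apply/funext => w; rewrite mulr1.
rewrite (@Ex_agree _ _ _ _ _ P1 _ _ P2 X1 X2 _ (fun=> 1))//.
- by congr Ex; apply/funext => w; rewrite mulr1.
- exact: bmf_cst.
- exact: bmf_cst.
move=> E mE.
transitivity (Ex P1 \1_(X1 @^-1` E)).
  by congr Ex; apply/funext => w; rewrite mulr1.
rewrite Ex_indic; last by rewrite -[Y in measurable Y]setTI; exact: mX1.
rewrite law// -Ex_indic; last by rewrite -[Y in measurable Y]setTI; exact: mX2.
by congr Ex; apply/funext => w; rewrite mulr1.
Qed.

(** * Dynkin systems *)

Section pi_system.
Context d (T : measurableType d) (R : realType) (P : probability T R).

Lemma fine_prob_le A B : measurable A -> measurable B -> A `<=` B ->
  fine (P A) <= fine (P B).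
Proof.
by move=> mA mB AB; apply: fine_le; rewrite ?fin_num_measure// le_measure ?inE.
Qed.

Lemma Ex_indic_setD A B (f : T -> R) : measurable A -> measurable B -> bmf f ->
  B `<=` A ->
  Ex P (fun x => \1_(A `\` B) x * f x) =
  Ex P (fun x => \1_A x * f x) - Ex P (fun x => \1_B x * f x).
Proof.
move=> mA mB bf BA.
rewrite -ExB; try by apply: bmfM => //; exact: bmf_indic.
congr Ex; apply/funext => x; rewrite -mulrBl; congr (_ * _).
rewrite !indicE; have [Bx|Bx] := boolP (x \in B).
  have -> : x \in A by rewrite inE; apply: BA; rewrite inE in Bx.
  by rewrite subrr memNset//= => -[_]; rewrite inE in Bx.
rewrite subr0; have [Ax|Ax] := boolP (x \in A).
  by rewrite mem_set//=; split; rewrite ?inE in Ax *; rewrite ?notin_setE in Bx *.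
by rewrite memNset// => -[Ax' _]; rewrite notin_setE in Ax.
Qed.

Lemma prob_bigcup_approx (F : (set T)^nat) e : (forall n, measurable (F n)) ->
  {homo F : n m / (n <= m)%N >-> n `<=` m} -> 0 < e ->
  exists n, fine (P (\bigcup_k F k `\` F n)) <= e.
Proof.
move=> mF ndF e0.
have mU : measurable (\bigcup_k F k) by exact: bigcup_measurable.
have cv : P (F n) @[n --> \oo] --> P (\bigcup_k F k).
  apply: nondecreasing_cvg_mu => //.
  by move=> n m nm; apply/subsetPset; exact: ndF.
move: cv; rewrite -[P (\bigcup_k F k)]fineK ?fin_num_measure//.
move=> /fine_cvgP[_ /cvgrPdist_le /(_ e e0)][N _ /(_ N (leqnn N))] /=.
move=> h; exists N; rewrite measureD//; last by rewrite -ge0_fin_numE ?fin_num_measure.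
rewrite setIidr; last by apply: bigcup_sup.
by rewrite fineB ?fin_num_measure// (le_trans _ h)// ler_norm.
Qed.

(** Proper differences pass by linearity, increasing unions because [f] is bounded and the part
    still missing has small probability. For [f] a noise, the conclusion says that it is centred
    given the sigma-algebra. *)
Lemma Ex_eq0_sigma (G : set (set T)) (f : T -> R) : setI_closed G ->
  G setT -> G `<=` measurable -> bmf f ->
  (forall A, G A -> Ex P (fun x => \1_A x * f x) = 0) ->
  forall A, <<s G >> A -> Ex P (fun x => \1_A x * f x) = 0.
Proof.
move=> GI GT Gm bf G0 A sGA; have [_ [M fM]] := bf.
pose H := [set B | measurable B /\ Ex P (fun x => \1_B x * f x) = 0].
suff : <<s G >> `<=` H by move=> /(_ A sGA)[].
apply: lambda_system_subset; [by []| |by move=> B GB; split; [exact: Gm|exact: G0]|by []].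
split => //.
- by split => //; exact: G0.
- move=> B C CB [mB B0] [mC C0]; split; first exact: measurableD.
    by rewrite Ex_indic_setD// B0 C0 subrr.
- move=> F ndF HF; have mF n : measurable (F n) by case: (HF n).
    have mU : measurable (\bigcup_k F k) by exact: bigcup_measurable.
    split => //.
    have M0 : 0 <= M by rewrite (le_trans _ (fM point)).
    apply/eqP; rewrite -normr_le0; apply/ler_addgt0Pr => e e0; rewrite add0r.
    (* [M + 1] instead of [M] keeps the divisor positive when the bound is 0. *)
    have e1 : 0 < e / (M + 1) by rewrite divr_gt0// ltr_wpDl.
    have [n hn] := prob_bigcup_approx mF
      (fun n m nm => subsetPset _ _ (ndF n m nm)) e1.
    have mD : measurable (\bigcup_k F k `\` F n) by exact: measurableD.
    have := @Ex_indic_setD _ _ f mU (mF n) bf (@bigcup_sup _ _ n setT F I).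
    rewrite (HF n).2 subr0 => <-.
    have bD : bmf (\1_(\bigcup_k F k `\` F n) : T -> R) by exact: bmf_indic.
    apply: (@le_trans _ _ (M * fine (P (\bigcup_k F k `\` F n)))); last first.
      rewrite (@le_trans _ _ (M * (e / (M + 1))))// ?ler_wpM2l//.
      by rewrite mulrCA ler_piMr ?(ltW e0)// ler_pdivrMr ?ltr_wpDl// mul1r lerDl.
    rewrite -Ex_indic// -ExZ// ler_norml -mulN1r -ExZ; last first.
      by apply: bmfM => //; exact: bmf_cst.
    apply/andP; split; apply: le_Ex; do ?[exact: bmf_cst|apply: bmfM => //].
      move=> x; rewrite mulN1r mulrC -mulrN ler_wpM2l//.
      by rewrite lerNl (le_trans _ (fM x))// -normrN ler_norm.
    by move=> x; rewrite mulrC ler_wpM2r// (le_trans _ (fM x))// ler_norm.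
Qed.

End pi_system.

(** * Strong law of large numbers *)

Section smallo.
Context (R : realType).
Implicit Types a b : nat -> R.

(** [a n = o(n)]. Sums stay unnormalised, so that error bounds simply add up; division by [n] occurs
    only in [smallo_cvg]. *)
Definition smallo a := forall e : R, 0 < e ->
  exists N, forall n, (N <= n)%N -> `|a n| <= e * n%:R.

Lemma smalloD a b : smallo a -> smallo b -> smallo (fun n => a n + b n).
Proof.
move=> sa sb e e0; have e20 : 0 < e / 2 by rewrite divr_gt0.
have [N hN] := sa _ e20; have [M hM] := sb _ e20.
exists (maxn N M) => n; rewrite geq_max => /andP[Nn Mn].
rewrite (le_trans (ler_normD _ _))// [e]splitr mulrDl lerD ?hN ?hM//.
Qed.

Lemma smallo_le a b : (forall n, `|a n| <= b n) -> smallo b -> smallo a.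
Proof.
move=> ab sb e e0; have [N hN] := sb e e0; exists N => n Nn.
by rewrite (le_trans (ab n))// (le_trans _ (hN n Nn))// ler_norm.
Qed.

Lemma smalloZ c a : smallo a -> smallo (fun n => c * a n).
Proof.
move=> sa e e0; have c0 : 0 < `|c| + 1 by rewrite ltr_wpDl.
have [N hN] := sa (e / (`|c| + 1)) (divr_gt0 e0 c0).
exists N => n Nn; rewrite normrM.
rewrite (@le_trans _ _ ((`|c| + 1) * `|a n|))// ?ler_wpM2r ?lerDl//.
by rewrite -ler_pdivlMl// mulrA [_^-1 * _]mulrC hN.
Qed.

Lemma smallo_cst c : smallo (fun _ => c).
Proof.
move=> e e0; exists (Num.truncn (`|c| / e)).+1 => n Nn.
by rewrite -ler_pdivrMl// mulrC (le_trans (ltW (truncnS_gt _)))// ler_nat.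
Qed.

Lemma smallo_approx a : (forall e : R, 0 < e -> exists2 b, smallo b &
  forall n, `|a n| <= e * n%:R + b n) -> smallo a.
Proof.
move=> h e e0; have e20 : 0 < e / 2 by rewrite divr_gt0.
have [b sb ab] := h _ e20; have [N hN] := sb _ e20; exists N => n Nn.
rewrite (le_trans (ab n))// [X in _ <= X * _]splitr mulrDl lerD2l.
by rewrite (le_trans _ (hN n Nn))// ler_norm.
Qed.

Lemma smallo_sum I (s : seq I) (a : I -> nat -> R) :
  (forall i, smallo (a i)) -> smallo (fun n => \sum_(i <- s) a i n).
Proof.
move=> sa; elim: s => [|i s IH].
  by apply: smallo_le (smallo_cst 0) => n; rewrite big_nil normr0.
apply: smallo_le (_ : smallo (fun n => `|a i n| + `|\sum_(j <- s) a j n|)).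
  by move=> n; rewrite big_cons ler_normD.
by apply: smalloD; [move: (sa i)|move: IH] => sb e e0;
  have [N hN] := sb e e0; exists N => n Nn; rewrite normr_id hN.
Qed.

Lemma smallo_norm a : smallo a -> smallo (fun n => `|a n|).
Proof.
by move=> sa e e0; have [N hN] := sa e e0; exists N => n Nn; rewrite normr_id hN.
Qed.

Lemma smallo_cvg a : smallo a -> (a n / n%:R) @[n --> \oo] --> (0 : R).
Proof.
move=> sa; apply/cvgrPdist_le => e e0; have [N hN] := sa e e0.
exists N.+1 => // n /= Nn; rewrite sub0r normrN normrM.
have n0 : 0 < n%:R :> R by rewrite ltr0n (leq_ltn_trans _ Nn).
by rewrite normfV [ `|n%:R| ]ger0_norm ?ler_pdivrMr// ?hN// ltnW.
Qed.

Lemma floor_sqrt n : exists m, (m ^ 2 <= n < m.+1 ^ 2)%N.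
Proof.
elim: n => [|n [m /andP[h1 h2]]]; first by exists 0.
have [h|h] := ltnP n.+1 (m.+1 ^ 2); first by exists m; rewrite h leqW.
exists m.+1; rewrite h (leq_ltn_trans h2)// ltn_sqr//.
Qed.

(** An index between [m^2] and [(m+1)^2] exceeds [m^2] by at most [2m], so [a] has moved by at most
    [2Cm], which is negligible against [m^2]. The condition along squares has the form that
    Borel-Cantelli delivers. *)
Lemma smallo_squares (a : nat -> R) (C : R) :
  (forall n, `|a n.+1 - a n| <= C) ->
  (forall k : nat, exists N, forall m, (N <= m)%N ->
     (a (m.+1 ^ 2)%N / (m.+1 ^ 2)%:R) ^+ 2 < k.+1%:R^-1) ->
  smallo a.
Proof.
move=> aC h e e0.
have C0 : 0 <= C by rewrite (le_trans _ (aC 0%N)).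
have lip n m : `|a (n + m)%N - a n| <= C * m%:R.
  elim: m => [|m IH]; first by rewrite addn0 subrr normr0 mulr0.
  rewrite addnS -natr1 mulrDr mulr1 (le_trans (ler_distD (a (n + m)%N) _ _))//.
  by rewrite addrC lerD.
(* Gives [1/(k+1) <= (e/2)^2]. *)
pose k := Num.truncn ((e / 2) ^- 2).
have [N hN] := h k.
(* The first entry makes [m - 1] at least [N]; the second gives [4C <= e * m], hence
   [2Cm <= (e/2) * m^2]. *)
pose M := maxn N.+1 (Num.truncn (4 * C / e)).+1.
exists (M ^ 2)%N => n Mn; have [m /andP[mn nm]] := floor_sqrt n.
have Mm : (M <= m)%N by rewrite -ltnS -ltn_sqr (leq_ltn_trans Mn).
have m0 : (0 < m)%N by rewrite (leq_trans _ Mm)// leq_max.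
have m0' : 0 < (m ^ 2)%:R :> R by rewrite ltr0n expn_gt0 m0.
have e20 : 0 < e / 2 by rewrite divr_gt0.
have am : `|a (m ^ 2)%N| <= e / 2 * (m ^ 2)%:R.
  rewrite -ler_pdivrMr// -[X in _ / X]ger0_norm ?(ltW m0')// -normf_div.
  rewrite -(@ler_pXn2r _ 2%N) ?nnegrE ?(ltW e20)//.
  rewrite real_normK ?num_real//.
  have Nm : (N <= m.-1)%N.
    by rewrite -ltnS prednK// (leq_trans _ Mm)// leq_maxl.
  have := hN _ Nm; rewrite prednK// => /ltW/le_trans; apply.
  rewrite -[X in _ <= X]invrK lef_pV2 ?posrE ?ltr0n ?invr_gt0 ?exprn_gt0//.
  exact/ltW/truncnS_gt.
have -> : a n = a (m ^ 2)%N + (a (m ^ 2 + (n - m ^ 2))%N - a (m ^ 2)%N).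
  by rewrite subnKC// addrC subrK.
rewrite (le_trans (ler_normD _ _))// [X in _ <= X * _]splitr mulrDl lerD//.
  by rewrite (le_trans am)// ler_wpM2l ?(ltW e20)// ler_nat.
rewrite (le_trans (lip _ _))//.
have h1 : (n - m ^ 2)%:R <= (2 * m)%:R :> R.
  rewrite ler_nat leq_subLR; move: nm; rewrite -!mulnn; nia.
rewrite (@le_trans _ _ (C * (2 * m)%:R))// ?ler_wpM2l//.
have h2 : 4 * C <= e * m%:R.
  rewrite -ler_pdivrMl// mulrC
     (le_trans (ltW (truncnS_gt _)))// ler_nat (leq_trans _ Mm)//.
  by rewrite leq_maxr.
have h3 : m%:R * m%:R <= n%:R :> R by rewrite -natrM ler_nat mulnn.
have hm : 0 <= m%:R :> R by [].
rewrite natrM; nra.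
Qed.

End smallo.

(** * Borel-Cantelli and second moments *)

Section almost_sure.
Context d (T : measurableType d) (R : realType) (P : probability T R).

Lemma series_sq_bound (C : R) n : 0 <= C ->
  \sum_(m < n) C / (m.+1 ^ 2)%:R <= 2 * C.
Proof.
(* The bound [2C] alone is not inductive; subtracting [2C/(n+1)], which telescopes, makes it so. *)
move=> C0; suff : \sum_(m < n) C / (m.+1 ^ 2)%:R <= 2 * C - 2 * C / n.+1%:R.
  by move=> /le_trans; apply; rewrite gerBl divr_ge0// mulr_ge0.
elim: n => [|n IH]; first by rewrite big_ord0 divr1 subrr.
rewrite big_ord_recr /= (le_trans (lerD IH (lexx _)))//.
have n1 : 0 < n.+1%:R :> R by rewrite ltr0n.
have n2 : 0 < n.+2%:R :> R by rewrite ltr0n.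
rewrite -subr_ge0 natrX.
have -> : 2 * C - 2 * C / n.+2%:R - (2 * C - 2 * C / n.+1%:R + C / n.+1%:R ^+ 2)
    = C * n%:R / (n.+1%:R ^+ 2 * n.+2%:R).
  have n0 : 0 <= n%:R :> R by [].
  rewrite -[n.+2%:R]natr1 -[n.+1%:R]natr1; field.
  by rewrite !gt_eqF ?ltr_wpDl// -addrA ltr_wpDl.
by rewrite divr_ge0 ?mulr_ge0// ltW// mulr_gt0// exprn_gt0.
Qed.

(** Markov's inequality at the level [1/(k+1)], then Borel-Cantelli. Countably many levels suffice,
    so the quantifier over them stays inside the almost sure statement. *)
Lemma ae_eventually_small (Y : nat -> T -> R) (C : R) :
  (forall m, bmf (Y m)) -> (forall m x, 0 <= Y m x) ->
  (forall m, Ex P (Y m) <= C / (m.+1 ^ 2)%:R) ->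
  {ae P, forall w, forall k : nat, exists N, forall m, (N <= m)%N ->
    Y m w < k.+1%:R^-1}.
Proof.
move=> bY Y0 YC; apply: ae_foralln => k.
pose A m := [set w | k.+1%:R^-1 <= Y m w].
have mA m : measurable (A m).
  rewrite /A (_ : [set _ | _] = Y m @^-1` `[k.+1%:R^-1, +oo[).
    by rewrite -[X in measurable X]setTI; apply: (bmf_measurable (bY m)).
  by apply/seteqP; split => x /=; rewrite in_itv/= andbT.
have C0 : 0 <= C.
  have := le_trans (Ex_ge0 P (Y0 0%N)) (YC 0%N).
  by rewrite exp1n divr1.
have PA m : fine (P (A m)) <= k.+1%:R * C / (m.+1 ^ 2)%:R.
  rewrite -mulrA -ler_pdivrMl// (le_trans _ (YC m))//.
  rewrite -Ex_indic// -ExZ; last exact: bmf_indic.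
  apply: le_Ex => //; first by apply: bmfM; [exact: bmf_cst|exact: bmf_indic].
  move=> x; rewrite indicE; have [xA|xA] := boolP (x \in A m).
    by rewrite mulr1; rewrite inE in xA.
  by rewrite mulr0.
have sumA : (\sum_(m <oo) P (A m) < +oo)%E.
  apply: (@le_lt_trans _ _ (2 * (k.+1%:R * C))%:E); last exact: ltry.
  apply: lime_le; first exact: is_cvg_nneseries.
  apply: nearW => n; rewrite big_mkord.
  rewrite (eq_bigr (fun m : 'I_n => (fine (P (A m)))%:E)).
    rewrite sumEFin lee_fin (le_trans _ (@series_sq_bound (k.+1%:R * C) n _))//.
      by apply: ler_sum => i _.
    by rewrite mulr_ge0.
  by move=> m _; rewrite fineK// fin_num_measure.
have mL : measurable (lim_sup_set A).
  by apply: bigcapT_measurable => n; apply: bigcup_measurable => j _.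
exists (lim_sup_set A); split => //; first exact: lim_sup_set_cvg0.
move=> w /= nw n _; apply: contrapT => h; apply: nw.
exists n => m nm; rewrite ltNge; apply/negP => kY.
by apply: h; exists m.
Qed.

(** Along squares [S n / n] has second moment at most [C/m^2], which is summable; along all integers
    the bound [C/n] would not be. The almost sure increment bound fills the gaps between squares. *)
Lemma ae_smallo_of_second_moment (S : nat -> T -> R) (C : R) :
  (forall n, bmf (S n)) ->
  (forall n, Ex P (fun w => S n w ^+ 2) <= C * n%:R) ->
  {ae P, forall w, forall n, `|S n.+1 w - S n w| <= C} ->
  {ae P, forall w, smallo (S ^~ w)}.
Proof.
move=> bS S2 SC.
pose Y m w := (S (m.+1 ^ 2)%N w / (m.+1 ^ 2)%:R) ^+ 2.
have bY m : bmf (Y m).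
  rewrite /Y (_ : (fun _ => _) = fun w => (S (m.+1 ^ 2)%N w / (m.+1 ^ 2)%:R) *
      (S (m.+1 ^ 2)%N w / (m.+1 ^ 2)%:R)); last first.
    by apply/funext => w; rewrite expr2.
  by apply: bmfM; apply: bmfM => //; exact: bmf_cst.
have Y0 m x : 0 <= Y m x by rewrite sqr_ge0.
have YC m : Ex P (Y m) <= C / (m.+1 ^ 2)%:R.
  have -> : Y m = fun w => ((m.+1 ^ 2)%:R ^- 2) * (S (m.+1 ^ 2)%N w ^+ 2).
    by apply/funext => w; rewrite /Y exprMn mulrC exprVn.
  rewrite ExZ; last first.
    rewrite (_ : (fun _ => _) = fun w => S (m.+1 ^ 2)%N w * S (m.+1 ^ 2)%N w).
      exact: bmfM.
    by apply/funext => w; rewrite expr2.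
  have m0 : 0 < (m.+1 ^ 2)%:R :> R by rewrite ltr0n expn_gt0.
  rewrite ler_pdivrMl ?exprn_gt0// (le_trans (S2 _))//.
  by rewrite [X in _ <= X](_ : _ = C * (m.+1 ^ 2)%:R)//; field; rewrite gt_eqF.
have := ae_eventually_small bY Y0 YC.
move: SC; apply: filterS2 => w SC h; exact: (@smallo_squares _ _ C).
Qed.

End almost_sure.

Section independence_expectation.
Context d (T : measurableType d) (R : realType) (P : probability T R).
Context d1 (T1 : measurableType d1).

Lemma Ex_indep_set (X : T -> T1) (E : set T) (phi : T1 -> R) :
  measurable_fun setT X -> measurable E ->
  (forall C, measurable C -> P (X @^-1` C `&` E) = (P (X @^-1` C) * P E)%E) ->
  measurable_fun setT phi -> (forall x, 0 <= phi x <= 1) ->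
  Ex P (fun w => phi (X w) * \1_E w) = Ex P (fun w => phi (X w)) * fine (P E).
Proof.
move=> mX mE ind mphi phi01.
have mXC C : measurable C -> measurable (X @^-1` C).
  by move=> mC; rewrite -[X in measurable X]setTI; exact: mX.
rewrite (@Ex_agree _ T1 R _ _ P _ _ P X X _ (fun=> fine (P E)))//.
- rewrite [RHS]mulrC -ExZ; last by apply: bmf_comp => //; exact: bmf01.
  by congr Ex; apply/funext => w; rewrite mulrC.
- exact: bmf_indic.
- exact: bmf_cst.
- move=> C mC.
  transitivity (Ex P \1_(X @^-1` C `&` E)).
    by congr Ex; apply/funext => w; rewrite indicI.
  rewrite Ex_indic; last by apply: measurableI => //; exact: mXC.
  rewrite ind// fineM ?fin_num_measure//; try exact: mXC.
  rewrite -(Ex_indic P (mXC _ mC)) mulrC -ExZ; last first.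
    by apply: bmf_indic; exact: mXC.
  by congr Ex; apply/funext => w; rewrite mulrC.
Qed.

Context d2 (T2 : measurableType d2).

Lemma Ex_indep (X : T -> T1) (Y : T -> T2) (phi : T1 -> R) (psi : T2 -> R) :
  measurable_fun setT X -> measurable_fun setT Y ->
  (forall C D, measurable C -> measurable D ->
    P (X @^-1` C `&` Y @^-1` D) = (P (X @^-1` C) * P (Y @^-1` D))%E) ->
  measurable_fun setT phi -> (forall x, 0 <= phi x <= 1) ->
  measurable_fun setT psi -> (forall x, 0 <= psi x <= 1) ->
  Ex P (fun w => phi (X w) * psi (Y w)) =
  Ex P (fun w => phi (X w)) * Ex P (fun w => psi (Y w)).
Proof.
move=> mX mY ind mphi phi01 mpsi psi01.
have mYC C : measurable C -> measurable (Y @^-1` C).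
  by move=> mC; rewrite -[X in measurable X]setTI; exact: mY.
have bphi : bmf (fun w => phi (X w)) by apply: bmf_comp => //; exact: bmf01.
have bpsi : bmf (fun w => psi (Y w)) by apply: bmf_comp => //; exact: bmf01.
transitivity (Ex P (fun w => psi (Y w) * phi (X w))).
  by congr Ex; apply/funext => w; rewrite mulrC.
rewrite (@Ex_agree _ T2 R _ _ P _ _ P Y Y _ (fun=> Ex P (fun w => phi (X w))))//.
- rewrite -ExZ//.
  by congr Ex; apply/funext => w; rewrite mulrC.
- exact: bmf_cst.
- move=> D mD.
  transitivity (Ex P (fun w => phi (X w) * \1_(Y @^-1` D) w)).
    by congr Ex; apply/funext => w; rewrite mulrC.
  rewrite Ex_indep_set//; last 2 first.
    exact: mYC.
    by move=> C mC; exact: ind.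
  rewrite -Ex_indic; last exact: mYC.
  rewrite -ExZ; last by apply: bmf_indic; exact: mYC.
  by congr Ex; apply/funext => w; rewrite mulrC.
Qed.

End independence_expectation.

Section slln.
Context d (T : measurableType d) (R : realType) (P : probability T R).
Context d1 (T1 : measurableType d1) (X : nat -> T -> T1).
Hypothesis mX : forall k, measurable_fun setT (X k).
Hypothesis indX : forall k l, k != l -> forall C D, measurable C -> measurable D ->
  P (X k @^-1` C `&` X l @^-1` D) = (P (X k @^-1` C) * P (X l @^-1` D))%E.
Hypothesis idX : forall k C, measurable C -> P (X k @^-1` C) = P (X 0%N @^-1` C).

Lemma Ex_identically_distributed (phi : T1 -> R) k : measurable_fun setT phi ->
  (forall x, 0 <= phi x <= 1) ->
  Ex P (fun w => phi (X k w)) = Ex P (fun w => phi (X 0%N w)).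
Proof. by move=> mphi phi01; apply: Ex_same_law => // C mC; exact: idX. Qed.

(** The centred summands are bounded by 1 and, by pairwise independence, orthogonal: the second
    moment of the sum is at most [n] and its increments at most 1. *)
Lemma slln (phi : T1 -> R) : measurable_fun setT phi ->
  (forall x, 0 <= phi x <= 1) ->
  {ae P, forall w, smallo (fun n =>
    \sum_(k < n) phi (X k w) - n%:R * Ex P (fun w => phi (X 0%N w)))}.
Proof.
move=> mphi phi01; set mu := Ex P _.
pose Y k w := phi (X k w) - mu.
have bp k : bmf (fun w => phi (X k w)) by apply: bmf_comp => //; exact: bmf01.
have mu01 : 0 <= mu <= 1.
  rewrite -(Ex_cst P 1); apply/andP; split.
    by apply: Ex_ge0 => w; case/andP: (phi01 (X 0%N w)).
  by apply: le_Ex => //; [exact: bmf_cst|move=> w; case/andP: (phi01 (X 0%N w))].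
have Y1 k w : `|Y k w| <= 1.
  move: (phi01 (X k w)) mu01 => /andP[p0 p1] /andP[m0 m1].
  by rewrite ler_norml /Y; apply/andP; split; lra.
have bY k : bmf (Y k) by apply: bmfB => //; exact: bmf_cst.
have YY k l : k != l -> Ex P (fun w => Y k w * Y l w) = 0.
  move=> kl.
  have -> : (fun w => Y k w * Y l w) = (fun w => (phi (X k w) * phi (X l w)
     + mu * mu) - (mu * phi (X k w) + mu * phi (X l w))).
    by apply/funext => w; rewrite /Y; ring.
  have bc c : bmf (fun _ : T => c : R) by exact: bmf_cst.
  rewrite ExB; [|apply: bmfD => //; exact: bmfM|by apply: bmfD; exact: bmfM].
  rewrite ExD//; last exact: bmfM.
  rewrite ExD; [|exact: bmfM|exact: bmfM].
  rewrite !ExZ// Ex_cst (Ex_indep _ _ (indX kl))//.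
  by rewrite !(Ex_identically_distributed _ mphi phi01) subrr.
pose S n w := \sum_(k < n) Y k w.
suff : {ae P, forall w, smallo (S ^~ w)}.
  apply: filterS => w; congr smallo; apply/funext => n.
  rewrite /S sumrB sumr_const card_ord.
  by congr (_ - _); rewrite -[LHS]mulr_natl.
apply: (@ae_smallo_of_second_moment _ _ _ _ _ 1).
- by move=> n; exact: bmf_sum.
- move=> n; rewrite mul1r.
  have -> : (fun w => S n w ^+ 2) =
      (fun w => \sum_(k < n) \sum_(l < n) Y k w * Y l w).
    apply/funext => w; rewrite expr2 /S mulr_suml.
    by apply: eq_bigr => k _; rewrite mulr_sumr.
  rewrite Ex_sum; last by move=> k; apply: bmf_sum => l; exact: bmfM.
  rewrite (@le_trans _ _ (\sum_(k < n) 1))//; last by rewrite sumr_const card_ord.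
  apply: ler_sum => k _; rewrite Ex_sum; last by move=> l; exact: bmfM.
  rewrite (bigD1 k)//= big1 ?addr0; last first.
    by move=> l lk; rewrite YY// eq_sym.
  rewrite (le_trans (ler_norm _))// norm_Ex_le//; first exact: bmfM.
  by move=> w; rewrite normrM mulr_ile1.
- apply: aeW => w n; by rewrite /S big_ord_recr/= addrAC subrr add0r.
Qed.

End slln.

(** * Geometry of nearest neighbours and ranks *)

Section grid.
Context (R : realType).

(** Pigeonhole: two points in one cell of side [1/q] differ by at most [1/q] in each coordinate.
    Shifted by [M] and scaled by [q], a coordinate has its integer part in [0, ..., 2Mq], hence the
    successor. *)
Lemma grid_card (n d M q : nat) (f : 'I_n -> 'I_d -> R) (A : {set 'I_n}) :
  (0 < q)%N ->
  (forall k i, k \in A -> `|f k i| <= M%:R) ->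
  (forall k l, k \in A -> l \in A -> k != l ->
     ~ forall i, `|f k i - f l i| <= q%:R^-1) ->
  (#|A| <= (2 * M * q).+1 ^ d)%N.
Proof.
move=> q0 fM sep.
have q0' : 0 < q%:R :> R by rewrite ltr0n.
have fM' k i : k \in A -> 0 <= f k i + M%:R <= 2 * M%:R.
  by move=> kA; have := fM k i kA; rewrite ler_norml => /andP[? ?]; apply/andP; split; lra.
pose c k i := Num.truncn ((f k i + M%:R) * q%:R).
pose cell k := [ffun i : 'I_d => inord (c k i) : 'I_(2 * M * q).+1].
have cP k i : k \in A -> (c k i < (2 * M * q).+1)%N.
  move=> kA; have /andP[h1 h2] := fM' k i kA.
  rewrite ltnS -(ler_nat R) !natrM.
  have /andP[h _] := truncn_itv (mulr_ge0 h1 (ltW q0')).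
  by rewrite (le_trans h)// ler_wpM2r// ltW.
have inj : {in A &, injective cell}.
  move=> k l kA lA kl; apply/eqP; apply: contraT => nkl; exfalso.
  apply: (sep k l kA lA nkl) => i.
  have ci : c k i = c l i.
    have := congr1 (fun g : {ffun _ -> _} => nat_of_ord (g i)) kl.
    by rewrite /cell !ffunE /= !inordK// cP.
  have /andP[hk _] := fM' k i kA; have /andP[hl _] := fM' l i lA.
  have /andP[k1 k2] := truncn_itv (mulr_ge0 hk (ltW q0')).
  have /andP[l1 l2] := truncn_itv (mulr_ge0 hl (ltW q0')).
  move: k1 k2 l1 l2; rewrite -/(c k i) -/(c l i) ci -natr1 => k1 k2 l1 l2.
  rewrite -[X in _ <= X]mul1r ler_pdivlMr// -[q%:R]ger0_norm ?(ltW q0')//.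
  rewrite -normrM ler_norml !mulrBl.
  by move: k1 k2 l1 l2; rewrite !mulrDl => *; apply/andP; split; lra.
by rewrite -(card_in_image inj) (leq_trans (max_card _))// card_ffun !card_ord.
Qed.

End grid.

Section nearest_neighbour_nat.
Context (R : realType) (d : nat).
Implicit Types (x : nat -> d.-tuple R) (u : nat -> R).

Definition sqdist (a b : d.-tuple R) : R :=
  \sum_(i < d) (coord i a - coord i b) ^+ 2.

Lemma sqdist_ge0 a b : 0 <= sqdist a b.
Proof. by apply: sumr_ge0 => i _; exact: sqr_ge0. Qed.

Lemma sqdistC a b : sqdist a b = sqdist b a.
Proof. by apply: eq_bigr => i _; rewrite -sqrrN opprB. Qed.

Lemma sqdist_coord a b i : (coord i a - coord i b) ^+ 2 <= sqdist a b.
Proof.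
by rewrite /sqdist (bigD1 i)//= lerDl sumr_ge0// => j _; exact: sqr_ge0.
Qed.

Lemma sqdist_gt0 a b : a != b -> 0 < sqdist a b.
Proof.
move=> ab; rewrite lt_neqAle sqdist_ge0 andbT eq_sym; apply: contra ab => /eqP h.
apply/eqP/eq_from_tnth => i; apply/eqP.
have := sqdist_coord a b i; rewrite h => h'.
by rewrite -subr_eq0 -sqrf_eq0 eq_le h' sqr_ge0.
Qed.

Lemma edist_le (a b a' b' : d.-tuple R) :
  (edist a b <= edist a' b') = (sqdist a b <= sqdist a' b').
Proof. by rewrite ler_sqrt// sqdist_ge0. Qed.

(* Counterparts of [nearest_neighbours] and [nearest_neighbour] indexed by
   [nat], so that samples of sizes [n] and [n.+1] can be compared. *)
Definition is_nn x n k j := (j != k) &&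
  all (fun l => (l != k) ==> (sqdist (x k) (x j) <= sqdist (x k) (x l))) (iota 0 n).

Definition nn_seq x n k := [seq j <- iota 0 n | is_nn x n k j].

Definition nn x u n k :=
  let s := nn_seq x n k in
  nth k s (minn (Num.truncn ((size s)%:R * u k)) (size s).-1).

Lemma nn_seqE x n (i : 'I_n) :
  map val (enum (nearest_neighbours (fun k : 'I_n => x k) i)) = nn_seq x n i.
Proof.
rewrite /nn_seq -val_enum_ord filter_map; congr map.
rewrite enumT [LHS]/enum_mem; apply: eq_filter => j /=.
rewrite !inE -val_eqE /=; congr andb.
apply/forallP/allP => [h l|h l].
  rewrite mem_iota /= => ln; have := h (Ordinal ln).
  by rewrite -val_eqE /= edist_le.
by rewrite -val_eqE edist_le; apply: h; rewrite mem_iota /= ltn_ord.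
Qed.

Lemma nearest_neighbourE x u n (i : 'I_n) :
  nearest_neighbour (fun k : 'I_n => x k) (fun k : 'I_n => u k) i = nn x u n i :> nat.
Proof.
rewrite /nearest_neighbour /nn -nn_seqE size_map.
set s := enum _; set m := minn _ _.
have [ms|ms] := ltnP m (size s).
  by rewrite (nth_map i).
by rewrite !nth_default// size_map.
Qed.

Lemma is_nnP x n k j : reflect
  (j != k /\ forall l, (l < n)%N -> l != k -> sqdist (x k) (x j) <= sqdist (x k) (x l))
  (is_nn x n k j).
Proof.
apply: (iffP andP) => -[jk h]; split => //.
  by move=> l ln lk; move/allP: h => /(_ l); rewrite mem_iota lk; exact.
by apply/allP => l; rewrite mem_iota => /h {}h; apply/implyP.
Qed.

Lemma mem_nn_seq x n k j : (j \in nn_seq x n k) = (j < n)%N && is_nn x n k j.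
Proof. by rewrite mem_filter mem_iota /= andbC. Qed.

Lemma nn_seq_neq0 x n k : (2 <= n)%N -> (k < n)%N -> (0 < size (nn_seq x n k))%N.
Proof.
move=> n2 kn; have n0 : (0 < n)%N by rewrite (leq_trans _ n2).
have [j0 j0k] : exists j : 'I_n, j != k :> nat.
  have [k0|k0] := eqVneq k 0%N; first by exists (Ordinal n2); rewrite k0.
  by exists (Ordinal n0); rewrite eq_sym.
case: (arg_minP (P := fun j : 'I_n => j != k :> nat)
  (fun j : 'I_n => sqdist (x k) (x j)) j0k) => j jk jmin.
rewrite -has_predT; apply/hasP; exists (val j) => //.
rewrite mem_nn_seq ltn_ord /=; apply/is_nnP; split => // l ln lk.
exact: (jmin (Ordinal ln)).
Qed.

Lemma nn_mem x u n k : (2 <= n)%N -> (k < n)%N -> nn x u n k \in nn_seq x n k.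
Proof.
move=> n2 kn; apply: mem_nth.
have := nn_seq_neq0 x n2 kn; case: (size _) => // m _.
by rewrite ltnS geq_minr.
Qed.

Lemma nn_lt x u n k : (2 <= n)%N -> (k < n)%N -> (nn x u n k < n)%N.
Proof. by move=> n2 kn; have := nn_mem x u n2 kn; rewrite mem_nn_seq => /andP[]. Qed.

Lemma nn_is_nn x u n k : (2 <= n)%N -> (k < n)%N -> is_nn x n k (nn x u n k).
Proof. by move=> n2 kn; have := nn_mem x u n2 kn; rewrite mem_nn_seq => /andP[]. Qed.

(** If the new point is not a nearest neighbour of [k], the whole list of nearest neighbours is
    unchanged, and the same [u k] selects the same entry. *)
Lemma nn_step x u n k : (k < n)%N -> ~~ is_nn x n.+1 k n ->
  nn x u n.+1 k = nn x u n k.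
Proof.
move=> kn nnn; have nk : n != k by rewrite gtn_eqF.
suff E : nn_seq x n.+1 k = nn_seq x n k by rewrite /nn E.
rewrite /nn_seq -addn1 iotaD filter_cat add0n /= addn1 (negbTE nnn) cats0.
apply: eq_in_filter => j; rewrite mem_iota /= add0n => jn.
(* Some old point is strictly closer than the new one, so minimality among the old points already
   implies minimality against the new one. *)
have [l [ln lk ll]] : exists l, [/\ (l < n)%N, l != k &
    sqdist (x k) (x l) < sqdist (x k) (x n)].
  apply: contrapT => h; move/negP: nnn; apply; apply/is_nnP; split => // l.
  rewrite ltnS leq_eqVlt => /predU1P[->//|ln] lk.
  by rewrite leNgt; apply/negP => ll; apply: h; exists l.
apply/is_nnP/is_nnP => -[jk h]; split => // i.
  by move=> iN; apply: h; rewrite ltnS ltnW.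
rewrite ltnS leq_eqVlt => /predU1P[->_|iN]; last exact: h.
by rewrite (le_trans (h _ ln lk))// ltW.
Qed.

End nearest_neighbour_nat.

(** * Counting points by their nearest neighbours *)

Section kissing.
Context (R : realType) (d : nat).

Lemma sum_sqrB (a b : 'I_d -> R) c e :
  \sum_i (c * a i - e * b i) ^+ 2 = c ^+ 2 * (\sum_i a i ^+ 2)
    + e ^+ 2 * (\sum_i b i ^+ 2) - 2 * c * e * (\sum_i a i * b i).
Proof.
rewrite !mulr_sumr -big_split -sumrB; apply: eq_bigr => i _ /=; ring.
Qed.

(* If the side opposite to the origin is the longest one of a triangle, the
   angle at the origin is at least 60 degrees. *)
Lemma normalized_separation (a b : 'I_d -> R) (A := \sum_i a i ^+ 2)
    (B := \sum_i b i ^+ 2) (D := \sum_i (a i - b i) ^+ 2) :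
  0 < A -> 0 < B -> A <= D -> B <= D ->
  1 <= \sum_i (a i / Num.sqrt A - b i / Num.sqrt B) ^+ 2.
Proof.
move=> A0 B0 AD BD.
have DE : D = A + B - 2 * (\sum_i a i * b i).
  have := sum_sqrB a b 1 1; rewrite expr1n !mulr1 !mul1r => <-.
  by apply: eq_bigr => i _; rewrite !mul1r.
set S := \sum_i a i * b i in DE.
have := sum_sqrB a b (Num.sqrt A)^-1 (Num.sqrt B)^-1.
rewrite (eq_bigr (fun i => (a i / Num.sqrt A - b i / Num.sqrt B) ^+ 2)); last first.
  by move=> i _; rewrite ![_^-1 * _]mulrC.
move=> ->; rewrite -/A -/B -/S.
have EA := sqr_sqrtr (ltW A0); have EB := sqr_sqrtr (ltW B0).
have a0 : 0 < Num.sqrt A by rewrite sqrtr_gt0.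
have b0 : 0 < Num.sqrt B by rewrite sqrtr_gt0.
move: a0 b0 EA EB; set al := Num.sqrt A; set be := Num.sqrt B => a0 b0 EA EB.
(* [A <= D] gives [2S <= B] and [B <= D] gives [2S <= A]; the smaller of [A] and [B] is at most
   their geometric mean. *)
have h : 2 * S <= al * be.
  have h1 : 2 * S <= A by lra.
  have h2 : 2 * S <= B by lra.
  have [ab|ba] := leP al be.
    by rewrite (le_trans h1)// -EA expr2 ler_pM2l.
  by rewrite (le_trans h2)// -EB expr2 ler_pM2r// ltW.
have -> : al^-1 ^+ 2 * A + be^-1 ^+ 2 * B - 2 * al^-1 * be^-1 * S
   = 2 - (2 * S) / (al * be).
  by rewrite -EA -EB; field; rewrite !gt_eqF.
have : 2 * S / (al * be) <= 1 by rewrite ler_pdivrMr ?mulr_gt0// mul1r.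
by move=> ?; lra.
Qed.

(** The number of cells in [grid_card] for the cube [[-1,1]^d] and side [1/(d+1)]: points in one
    cell have squared distance at most [d/(d+1)^2 < 1]. *)
Definition kissing_bound : nat := ((2 * 1 * d.+1).+1 ^ d)%N.

Lemma sum_bool_card n (p : pred nat) :
  (\sum_(k < n) (p k : nat) = #|[set k : 'I_n | p k]%SET|)%N.
Proof.
rewrite -sum1dep_card big_mkcond /= [RHS]big_mkcond /=.
by apply: eq_bigr => k _; case: (p k).
Qed.

(** If [j] is a nearest neighbour of both [k] and [l], the side from [x k] to [x l] is the longest
    of the triangle, so the unit directions from [x j] are at distance at least 1 and lie in
    different grid cells. Distinctness makes these directions well defined. Ties are counted in
    full. *)
Lemma kissing (x : nat -> d.-tuple R) n j :
  (j < n)%N ->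
  (forall k l, (k < n)%N -> (l < n)%N -> k != l -> x k != x l) ->
  (\sum_(k < n) (is_nn x n k j : nat) <= kissing_bound)%N.
Proof.
move=> jn inj; rewrite (sum_bool_card n (fun k => is_nn x n k j)).
pose r k : R := Num.sqrt (sqdist (x k) (x j)).
pose f (k : 'I_n) (i : 'I_d) := (coord i (x k) - coord i (x j)) / r k.
have pos (k : 'I_n) : is_nn x n k j -> 0 < sqdist (x k) (x j).
  by move=> /is_nnP[jk _]; apply: sqdist_gt0; apply: inj => //; rewrite eq_sym.
apply: (@grid_card R n d 1 d.+1 f) => //.
- move=> k i; rewrite inE => /pos p.
  rewrite -sqrtr_sqr -[X in _ <= X]sqrtr1 ler_sqrt// /f exprMn exprVn sqr_sqrtr ?(ltW p)//.
  by rewrite ler_pdivrMr// mul1r; exact: sqdist_coord.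
- move=> k l; rewrite !inE => kj lj kl h.
  have k0 := pos _ kj; have l0 := pos _ lj.
  move: kj lj => /is_nnP[kj hk] /is_nnP[lj hl].
  have := @normalized_separation (fun i => coord i (x k) - coord i (x j))
    (fun i => coord i (x l) - coord i (x j)) k0 l0.
  have E : \sum_i (coord i (x k) - coord i (x j) - (coord i (x l) - coord i (x j))) ^+ 2
     = sqdist (x k) (x l).
    by apply: eq_bigr => i _; rewrite opprB addrA subrK.
  have lk : l != k by rewrite eq_sym.
  have hA := hk l (ltn_ord l) lk; have hB := hl k (ltn_ord k) kl.
  rewrite E => /(_ hA); rewrite sqdistC => /(_ hB); apply/negP; rewrite -ltNge.
  apply: (@le_lt_trans _ _ (\sum_(i < d) d.+1%:R^-1 ^+ 2)).
    apply: ler_sum => i _; rewrite -[X in X <= _]real_normK ?num_real//.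
    by rewrite ler_pXn2r ?nnegrE// h.
  rewrite sumr_const card_ord -[_ *+ d]mulr_natl exprVn.
  rewrite ltr_pdivrMr ?exprn_gt0// mul1r.
  by rewrite -natrX ltr_nat -mulnn (@leq_trans d.+1)// leq_pmulr.
Qed.

Definition in_box (M : nat) (a : d.-tuple R) : bool :=
  [forall i, `|coord i a| <= M%:R].

(* A grid cell of diameter at most [sqrt D] holds at most one point whose
   nearest neighbour is farther away than that. *)
Lemma far_nn_bound (D : R) (M : nat) : 0 < D ->
  exists N, forall (x : nat -> d.-tuple R) (u : nat -> R) n, (2 <= n)%N ->
  (\sum_(k < n) (in_box M (x k) &&
     (D < sqdist (x k) (x (nn x u n k)))%R : nat) <= N)%N.
Proof.
(* [q > d/D] yields [d/q^2 <= d/q <= D], the squared diameter allowed for a cell. *)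
move=> D0; pose q := (Num.truncn (d%:R / D)).+1.
exists ((2 * M * q).+1 ^ d)%N => x u n n2; rewrite (sum_bool_card n (fun k => in_box M (x k) &&
  (D < sqdist (x k) (x (nn x u n k))))).
apply: (@grid_card R n d M q (fun k i => coord i (x k))) => //.
- by move=> k i; rewrite inE => /andP[/forallP].
- move=> k l; rewrite !inE => /andP[_ kD] _ kl h.
  have /is_nnP[_ /(_ l (ltn_ord l))] := nn_is_nn x u n2 (ltn_ord k).
  rewrite eq_sym => /(_ kl); apply/negP; rewrite -ltNge (le_lt_trans _ kD)//.
  apply: (@le_trans _ _ (\sum_(i < d) q%:R^-1 ^+ 2)).
    apply: ler_sum => i _; rewrite -[X in X <= _]real_normK ?num_real//.
    by rewrite ler_pXn2r ?nnegrE// h.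
  rewrite sumr_const card_ord -[_ *+ d]mulr_natl exprVn.
  rewrite ler_pdivrMr ?exprn_gt0//.
  rewrite mulrC -ler_pdivrMr// (le_trans (ltW (truncnS_gt _)))//.
  by rewrite -/q -natrX ler_nat -mulnn leq_pmulr.
Qed.

End kissing.

(** * Empirical ranks *)

Section ranks.
Context (R : realType) (n : nat) (y : 'I_n -> R).

Definition down_closed (p : pred 'I_n) := forall k l, y l <= y k -> p k -> p l.

(** Lower sets for a total preorder are nested, so all the differences have the same sign. *)
Lemma down_closed_symdiff (p q : pred 'I_n) : down_closed p -> down_closed q ->
  \sum_k `|(p k)%:R - (q k)%:R| = `|\sum_k (p k)%:R - \sum_k (q k)%:R| :> R.
Proof.
wlog pq : p q / forall k, p k -> q k.
  move=> h dp dq; have [pq|] := pselect (forall k, p k -> q k); first exact: h.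
  move=> /existsNP[k /not_implyP[pk /negP qk]].
  rewrite distrC -h//.
    by apply: eq_bigr => i _; rewrite distrC.
  move=> l ql; apply: (dp k) => //.
  by have [//|/ltW kl] := leP (y l) (y k); move: qk; rewrite (dq l).
move=> dp dq.
have E k : `|(p k)%:R - (q k)%:R| = (q k)%:R - (p k)%:R :> R.
  rewrite distrC ger0_norm// subr_ge0 ler_nat.
  by have := pq k; case: (p k) => // ->.
rewrite (eq_bigr _ (fun k _ => E k)) sumrB distrC ger0_norm// -sumrB.
by apply: sumr_ge0 => k _; rewrite -E.
Qed.

Definition num_le (c : R) : R := \sum_(l < n) (y l <= c)%R%:R.

Lemma scaled_ecdfE c : scaled_ecdf y c = n.+1%:R^-1 * num_le c.
Proof.
congr (_ * _); apply: eq_bigr => l _; rewrite indicE; congr (_%:R).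
by congr nat_of_bool; apply/idP/idP; rewrite inE /= in_itv.
Qed.

Lemma num_le_homo : {homo num_le : a b / a <= b}.
Proof.
move=> a b ab; apply: ler_sum => l _; rewrite ler_nat.
by have [la|//] := leP (y l) a; rewrite (le_trans la ab).
Qed.

Definition rank_le (s : R) (k : 'I_n) : bool := scaled_ecdf y (y k) <= s.

Lemma rank_leE s k : rank_le s k = (num_le (y k) <= s * n.+1%:R).
Proof. by rewrite /rank_le scaled_ecdfE ler_pdivrMl// mulrC. Qed.

Lemma down_closed_rank_le s : down_closed (rank_le s).
Proof. by move=> k l lk; rewrite !rank_leE; apply: le_trans; exact: num_le_homo. Qed.

(* The ranks of distinct values are exactly 1, ..., n. *)
Lemma count_rank_le s : (forall k l, k != l -> y k != y l) -> 0 <= s <= 1 ->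
  `|\sum_k (rank_le s k)%:R - s * n%:R| <= 1.
Proof.
move=> yinj /andP[s0 s1].
have n0 : 0 <= n%:R :> R by [].
have sn : s * n.+1%:R = s * n%:R + s by rewrite -natr1 mulrDr mulr1.
rewrite ler_norml; apply/andP; split.
  have [allp|] := pselect (forall k, rank_le s k).
    rewrite (eq_bigr (fun=> 1)); last by move=> k _; rewrite allp.
    rewrite sumr_const card_ord; have : s * n%:R <= n%:R by rewrite ler_piMl.
    by move=> ?; lra.
  move=> /existsNP[k0 /negP k0p].
  (* Every value below the smallest failing one passes, so its rank exceeds the number of passing
     indices by at most 1; failing means that this rank is above [s * (n+1)]. *)
  case: (arg_minP (P := fun k => ~~ rank_le s k) y k0p) => k kp kmin.
  have : num_le (y k) <= \sum_k (rank_le s k)%:R + 1.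
    rewrite [X in _ <= X + _](bigD1 k)//= (negbTE kp) add0r addrC.
    rewrite /num_le (bigD1 k)//= lexx lerD2l; apply: ler_sum => l lk.
    rewrite ler_nat; have [lek|//] := leP (y l) (y k).
    have [//|lp] := boolP (rank_le s l).
    have := yinj l k lk; rewrite -(negbK (_ == _)) => /negP; case.
    by rewrite eq_le lek kmin.
  by move: kp; rewrite rank_leE -ltNge sn => ? ?; lra.
have [/existsP[k0 k0p]|/existsPn np] := boolP [exists k, rank_le s k]; last first.
  rewrite big1 ?sub0r; last by move=> k _; rewrite (negbTE (np k)).
  by rewrite (@le_trans _ _ 0)// oppr_le0 mulr_ge0.
(* The rank of the largest passing value bounds the number of passing indices and is at most
   [s * (n+1)]. *)
case: (arg_maxP (P := rank_le s) y k0p) => k kp kmax.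
have : \sum_k (rank_le s k)%:R <= num_le (y k).
  apply: ler_sum => l _; rewrite ler_nat.
  by have [lp|//] := boolP (rank_le s l); have /= -> := kmax l lp.
by move: kp; rewrite rank_leE sn => ? ?; lra.
Qed.

Lemma sum_rank_le_symdiff (q : pred 'I_n) s : (forall k l, k != l -> y k != y l) ->
  0 <= s <= 1 -> down_closed q ->
  \sum_k `|(rank_le s k)%:R - (q k)%:R| <= 1 + `|\sum_k (q k)%:R - s * n%:R|.
Proof.
move=> yinj s01 dq; rewrite down_closed_symdiff//; last exact: down_closed_rank_le.
rewrite (le_trans (ler_distD (s * n%:R) _ _))// [X in _ + X <= _]distrC.
by rewrite lerD2r count_rank_le.
Qed.

Lemma indic_rank_le s k : \1_[set` `[0, s]] (scaled_ecdf y (y k)) = (rank_le s k)%:R :> R.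
Proof.
rewrite indicE /rank_le; congr (_%:R); congr nat_of_bool.
have p0 : 0 <= scaled_ecdf y (y k).
  by rewrite scaled_ecdfE mulr_ge0// sumr_ge0.
by apply/idP/idP; rewrite inE /= in_itv /= p0.
Qed.

End ranks.

(** * Independence and conditionally centred noise *)

Section discrete_measurability.
Context d0 (T : measurableType d0).

(** Measurability through fibres: a construction on lists and indices is handled by countable case
    splits, as in [dmeas_bind]. The space is generic because the results are used both for the
    ambient sigma-algebra and for the one generated by [pi_sets]. *)
Definition dmeas (V : countType) (f : T -> V) :=
  forall v, measurable [set w | f w = v].

Lemma dmeas_cst (V : countType) (v : V) : dmeas (fun _ : T => v).
Proof.
move=> v'; have [<-|h] := eqVneq v v'.
  by rewrite (_ : [set _ | _] = setT)//; apply/seteqP; split.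
by rewrite (_ : [set _ | _] = set0)//; apply/seteqP; split => // w /= /eqP;
  rewrite (negbTE h).
Qed.

Lemma dmeas_bind (V W : countType) (f : T -> V) (g : V -> T -> W) :
  dmeas f -> (forall v, dmeas (g v)) -> dmeas (fun w => g (f w) w).
Proof.
move=> mf mg v.
have -> : [set w | g (f w) w = v] =
    \bigcup_(x in [set: V]) ([set w | f w = x] `&` [set w | g x w = v]).
  apply/seteqP; split => [w /= <-|w [x _] [/= <-]//].
  by exists (f w).
apply: countable_bigcupT_measurable => // x.
by apply: measurableI; [exact: mf|exact: mg].
Qed.

Lemma dmeas_bool (f : T -> bool) : measurable [set w | f w] -> dmeas f.
Proof.
move=> mf [] //; rewrite (_ : [set _ | _] = ~` [set w | f w]).
  exact: measurableC.
by apply/seteqP; split => w /=; [move=> ->|move/negP/negbTE].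
Qed.

Lemma dmeas2 (V W X : countType) (F : V -> W -> X) (f : T -> V) (g : T -> W) :
  dmeas f -> dmeas g -> dmeas (fun w => F (f w) (g w)).
Proof.
move=> mf mg; apply: (dmeas_bind mf (g := fun v w => F v (g w))) => v.
by apply: (dmeas_bind mg (g := fun x _ => F v x)) => x; exact: dmeas_cst.
Qed.

Lemma dmeas_all_in (s : seq nat) (p : nat -> T -> bool) :
  {in s, forall i, dmeas (p i)} -> dmeas (fun w => all (fun i => p i w) s).
Proof.
elim: s => [|i s IH] mp /=; first exact: dmeas_cst.
apply: (dmeas2 andb); first by apply: mp; rewrite mem_head.
by apply: IH => j js; apply: mp; rewrite in_cons js orbT.
Qed.

Lemma dmeas_filter_in (s : seq nat) (p : nat -> T -> bool) :
  {in s, forall i, dmeas (p i)} -> dmeas (fun w => [seq i <- s | p i w]).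
Proof.
elim: s => [|i s IH] mp /=; first exact: dmeas_cst.
apply: (dmeas2 (fun b s' => if b then i :: s' else s')).
  by apply: mp; rewrite mem_head.
by apply: IH => j js; apply: mp; rewrite in_cons js orbT.
Qed.

Context (R : realType) (d : nat).
Variables (x : nat -> T -> d.-tuple R) (u : nat -> T -> R) (n : nat).
Hypothesis mx : forall k, (k < n)%N -> measurable_fun setT (x k).
Hypothesis mu : forall k, measurable_fun setT (u k).

Lemma measurable_sqdist k j : (k < n)%N -> (j < n)%N ->
  measurable_fun setT (fun w => sqdist (x k w) (x j w)).
Proof.
move=> kn jn; apply: measurable_sum => i; apply: measurable_funX.
apply: measurable_funB.
  exact: (measurableT_comp (measurable_coord i) (mx kn)).
exact: (measurableT_comp (measurable_coord i) (mx jn)).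
Qed.

Lemma dmeas_is_nn k j : (k < n)%N -> (j < n)%N ->
  dmeas (fun w => is_nn (x ^~ w) n k j).
Proof.
move=> kn jn; apply: (dmeas2 andb); first exact: dmeas_cst.
apply: dmeas_all_in => l; rewrite mem_iota /= add0n => ln.
apply: (dmeas2 implb); first exact: dmeas_cst.
apply: dmeas_bool.
have := measurable_fun_ler (measurable_sqdist kn jn) (measurable_sqdist kn ln).
by move=> /(_ measurableT [set true]); rewrite setTI; apply.
Qed.

(** First split on the list of nearest neighbours, then on the selected position. Only points of
    index below [n] are assumed measurable, since only those are available for [pi_sets]. *)
Lemma dmeas_nn k : (k < n)%N -> dmeas (fun w => nn (x ^~ w) (u ^~ w) n k).
Proof.
move=> kn.
have ms : dmeas (fun w => nn_seq (x ^~ w) n k).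
  apply: (dmeas_filter_in (s := iota 0 n) (p := fun j w => is_nn (x ^~ w) n k j)) => j.
  by rewrite mem_iota /= add0n => jn; exact: dmeas_is_nn.
apply: (dmeas_bind ms (g := fun s w =>
  nth k s (minn (Num.truncn ((size s)%:R * u k w)) (size s).-1))) => s.
have mt : dmeas (fun w => Num.truncn ((size s)%:R * u k w)).
  have mge m : measurable [set w | (m <= Num.truncn ((size s)%:R * u k w))%N].
    (* [m = 0] is separate: [truncn] is 0 on negative reals, where the comparison of real numbers
       would fail. *)
    case: m => [|m]; first by rewrite (_ : [set _ | _] = setT)//; apply/seteqP.
    rewrite (_ : [set _ | _] = (fun w => (size s)%:R * u k w) @^-1` `[m.+1%:R, +oo[).
      rewrite -[X in measurable X]setTI.
      have mm : measurable_fun setT (fun w => (size s)%:R * u k w).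
        by apply: measurable_funM; [exact: measurable_cst|exact: mu].
      by apply: mm.
    by apply/seteqP; split => w /=; rewrite in_itv /= andbT truncn_gt_nat.
  move=> m; rewrite (_ : [set _ | _] =
     [set w | (m <= Num.truncn ((size s)%:R * u k w))%N] `\`
     [set w | (m.+1 <= Num.truncn ((size s)%:R * u k w))%N]).
    exact: measurableD.
  apply/seteqP; split => w /=; first by move=> ->; rewrite leqnn ltnn.
  by move=> [h1 h2]; apply/eqP; rewrite eqn_leq h1 andbT leqNgt; apply/negP.
apply: (dmeas_bind mt (g := fun m _ => nth k s (minn m (size s).-1))) => m.
exact: dmeas_cst.
Qed.

End discrete_measurability.

(** * Independence of one observation from the rest of the data *)

Section product_pi_system.
Context {disp : measure_display} {Omega : measurableType disp} {R : realType}.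
Context (P : probability Omega R) {d' : measure_display} {T : measurableType d'}.
Context (Z : nat -> {RV P >-> T}) (U : nat -> {RV P >-> R}).
Hypotheses (hZ : iid Z) (hZU : independent_processes Z U).

Lemma measurable_RV_preimage k C : measurable C -> measurable (Z k @^-1` C).
Proof. by move=> mC; exact: measurable_funPTI. Qed.

Lemma iid_indep_pair k l : k != l -> forall C D, measurable C -> measurable D ->
  P (Z k @^-1` C `&` Z l @^-1` D) = (P (Z k @^-1` C) * P (Z l @^-1` D))%E.
Proof.
move=> kl C D mC mD.
have [ind _] := hZ.
have := ind [fset k; l]%fset (fun i => if i == k then C else D).
rewrite big_fsetU1 ?inE//= big_seq_fset1 eqxx eq_sym (negbTE kl) => <-.
  congr (P _); apply/seteqP; split.
    move=> w [Ck Dl] i /=; rewrite !inE => /orP[/eqP ->|/eqP ->]; rewrite ?eqxx//.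
    by rewrite eq_sym (negbTE kl).
  move=> w h; split.
    by have := h k; rewrite /= !inE eqxx => /(_ isT).
  by have := h l; rewrite /= !inE eqxx orbT eq_sym (negbTE kl) => /(_ isT).
by move=> i; case: ifP.
Qed.

Lemma iid_identical k C : measurable C -> P (Z k @^-1` C) = P (Z 0%N @^-1` C).
Proof. by move=> mC; have [_ /(_ k C mC)] := hZ. Qed.

Definition others (n j : nat) (C : nat -> set T) : set Omega :=
  [set w | forall i, (i < n)%N -> i != j -> C i (Z i w)].

Lemma others_sigma_process n j C : (forall i, measurable (C i)) ->
  sigma_process Z (others n j C).
Proof.
move=> mC.
pose G := \bigcup_j preimage_set_system setT (Z j) measurable : set (set Omega).
have -> : others n j C =
   \bigcap_(i in [set i | (i < n)%N && (i != j)]) (Z i @^-1` C i).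
  apply/seteqP; split => w h i /=; first by move=> /andP[]; exact: h.
  by move=> i1 i2; apply: h => /=; rewrite i1.
have : G.-sigma.-measurable
   (\bigcap_(i in [set i | (i < n)%N && (i != j)]) (Z i @^-1` C i)).
  apply: (@fin_bigcap_measurable _ (g_sigma_algebraType G)) => [|i _].
    apply: (@sub_finite_set _ _ `I_n); last exact: finite_II.
    by move=> i /= /andP[].
  apply: sub_sigma_algebra; exists i => //; exists (C i) => //.
  by rewrite setTI.
by [].
Qed.

Lemma sigma_process_measurable E : sigma_process U E -> measurable E.
Proof.
have : sigma_process U `<=` measurable.
  apply: smallest_sub; first exact: sigma_algebra_measurable.
  by move=> _ [i _ [B mB <-]]; rewrite setTI; exact: measurable_funPTI.
exact.
Qed.

(** Joint independence of the sample splits off [Z j] from the other points; independence of the two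
    processes splits off [F], before and after that. *)
Lemma indep_others n j C F D : (forall i, measurable (C i)) ->
  sigma_process U F -> measurable D ->
  P (Z j @^-1` D `&` (others n j C `&` F)) =
  (P (Z j @^-1` D) * P (others n j C `&` F))%E.
Proof.
move=> mC sF mD; have [ind _] := hZ.
pose J0 := [fset i in [seq i <- iota 0 n | i != j]]%fset.
have J0E i : (i \in J0) = (i < n)%N && (i != j).
  by rewrite !inE mem_filter mem_iota /= add0n andbC.
have jJ0 : j \notin J0 by rewrite J0E eqxx andbF.
have oE : others n j C = \bigcap_(i in [set` J0]) (Z i @^-1` C i).
  apply/seteqP; split => w h i.
    by rewrite /= J0E => /andP[]; exact: h.
  by move=> i1 i2; apply: h; rewrite /= J0E i1.
pose B i := if i == j then D else C i.
have mB i : measurable (B i) by rewrite /B; case: ifP.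
have P1 : P (Z j @^-1` D `&` others n j C) =
    (P (Z j @^-1` D) * P (others n j C))%E.
  have -> : Z j @^-1` D `&` others n j C =
      \bigcap_(i in [set` (j |` J0)%fset]) (Z i @^-1` B i).
    rewrite oE; apply/seteqP; split => w.
      move=> [Dw Cw] i; rewrite /= in_fset1U /B => /orP[/eqP ->|iJ].
        by rewrite eqxx.
      rewrite ifN; first exact: Cw.
      by move: iJ; rewrite J0E => /andP[].
    move=> h; split; first by have := h j; rewrite /= in_fset1U eqxx /B eqxx => /(_ isT).
    move=> i iJ; have := h i; rewrite /= in_fset1U iJ orbT /B ifN; first exact.
    by move: iJ; rewrite /= J0E => /andP[].
  rewrite (ind _ _ mB) big_fsetU1//= {1}/B eqxx; congr (_ * _)%E.
  rewrite oE (ind _ _ mC); apply: eq_big_seq => i; rewrite J0E => /andP[_ ij].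
  by rewrite /B (negbTE ij).
have so := others_sigma_process n j mC.
have sjo : sigma_process Z (Z j @^-1` D `&` others n j C).
  pose G := \bigcup_j preimage_set_system setT (Z j) measurable : set (set Omega).
  have : G.-sigma.-measurable (Z j @^-1` D `&` others n j C).
    apply: measurableI; last exact: so.
    by apply: sub_sigma_algebra; exists j => //; exists D => //; rewrite setTI.
  by [].
by rewrite setIA (hZU sjo sF) P1 (hZU so sF) muleA.
Qed.

End product_pi_system.

Section mean_zero_noise.
Context {disp : measure_display} {Omega : measurableType disp} {R : realType}.
Context (P : probability Omega R) {d : nat}.
Context (Z : nat -> {RV P >-> d.+1.-tuple R}) (U : nat -> {RV P >-> R}).
Hypotheses (hZ : iid Z) (hZU : independent_processes Z U).
Context (F G : set (d.+1.-tuple R)) (h : d.-tuple R -> R).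
Hypotheses (mF : measurable F) (mG : measurable G).
Hypotheses (mh : measurable_fun setT h) (h01 : forall x, 0 <= h x <= 1).
(* [h (init_coords z)] is the conditional probability of [G]. *)
Hypothesis hG : forall B, measurable B ->
  Ex P (fun w => \1_B (init_coords (Z 0%N w)) * \1_G (Z 0%N w)) =
  Ex P (fun w => \1_B (init_coords (Z 0%N w)) * h (init_coords (Z 0%N w))).

Let X k w := init_coords (Z k w).

Lemma measurable_X k : measurable_fun setT (X k).
Proof. by apply: (measurableT_comp measurable_init_coords); exact: measurable_funPT. Qed.

Definition noise j w : R := \1_G (Z j w) - h (X j w).

Lemma bmf_indicG j : bmf (fun w => \1_G (Z j w) : R).
Proof. by apply: bmf_comp; [exact: bmf_indic|exact: measurable_funPT]. Qed.

Lemma bmf_hX j : bmf (fun w => h (X j w)).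
Proof. by apply: bmf_comp; [exact: bmf01|exact: measurable_X]. Qed.

Lemma bmf_noise j : bmf (noise j).
Proof. by apply: bmfB; [exact: bmf_indicG|exact: bmf_hX]. Qed.

Lemma noise_le1 j w : `|noise j w| <= 1.
Proof.
rewrite /noise indicE; have := h01 (X j w) => /andP[h0 h1].
by case: (_ \in _); rewrite ler_norml; apply/andP; split => /=; lra.
Qed.

(** Generators of the sigma-algebra of [X j], of the complete observations [Z i] with [i < n] and
    [i != j], and of all tie-breaking variables: everything except the response of [j]. *)
Definition pi_sets (n j : nat) : set (set Omega) :=
  [set E | exists B C S, [/\ measurable B, (forall i, measurable (C i)),
    sigma_process U S & E = X j @^-1` B `&` (others Z n j C `&` S)]].

Lemma sigma_processT : sigma_process U setT.
Proof.
pose H := \bigcup_j preimage_set_system setT (U j) measurable : set (set Omega).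
exact: (@measurableT _ (g_sigma_algebraType H)).
Qed.

Lemma pi_setsI n j : setI_closed (pi_sets n j).
Proof.
move=> _ _ [B [C [S [mB mC sS ->]]]] [B' [C' [S' [mB' mC' sS' ->]]]].
exists (B `&` B'), (fun i => C i `&` C' i), (S `&` S'); split.
- exact: measurableI.
- by move=> i; exact: measurableI.
- pose H := \bigcup_j preimage_set_system setT (U j) measurable : set (set Omega).
  exact: (@measurableI _ (g_sigma_algebraType H)).
- apply/seteqP; split => w /=.
    move=> [[Bw [Cw Sw]] [Bw' [Cw' Sw']]]; do !split => //.
      exact: Cw.
    exact: Cw'.
  move=> [[Bw Bw'] [Cw [Sw Sw']]]; do !split => //.
    by move=> i i1 i2; have [] := Cw i i1 i2.
  by move=> i i1 i2; have [] := Cw i i1 i2.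
Qed.

Lemma pi_setsT n j : pi_sets n j setT.
Proof.
exists setT, (fun=> setT), setT; split => //; first exact: sigma_processT.
by apply/seteqP; split => w.
Qed.

Lemma others_measurable n j C S : (forall i, measurable (C i)) ->
  sigma_process U S -> measurable (others Z n j C `&` S).
Proof.
move=> mC sS; apply: measurableI; last exact: sigma_process_measurable sS.
have -> : others Z n j C =
   \bigcap_(i in [set i | (i < n)%N && (i != j)]) (Z i @^-1` C i).
  apply/seteqP; split => w hh i /=; first by move=> /andP[]; exact: hh.
  by move=> i1 i2; apply: hh => /=; rewrite i1.
apply: bigcap_measurableType => i _; exact: measurable_RV_preimage.
Qed.

Lemma pi_sets_measurable n j : pi_sets n j `<=` measurable.
Proof.
move=> _ [B [C [S [mB mC sS ->]]]]; apply: measurableI.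
  by rewrite -[E in measurable E]setTI; exact: measurable_X.
exact: others_measurable.
Qed.

(** The part of [E] not concerning [Z j] is independent of [Z j] and factors out of both halves of
    the noise; what remains are the two sides of [hG]. *)
Lemma Ex_noise_pi n j E : pi_sets n j E -> Ex P (fun w => \1_E w * noise j w) = 0.
Proof.
move=> [B [C [S [mB mC sS ->]]]]; set O := others Z n j C `&` S.
have mO : measurable O by exact: others_measurable.
have mBX : measurable_fun setT (fun z : d.+1.-tuple R => \1_B (init_coords z) : R).
  exact: (measurableT_comp (measurable_indic mB) measurable_init_coords).
pose p1 z : R := \1_B (init_coords z) * \1_G z.
pose p2 z : R := \1_B (init_coords z) * h (init_coords z).
have mp1 : measurable_fun setT p1 by apply: measurable_funM.
have mp2 : measurable_fun setT p2.
  apply: measurable_funM => //.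
  exact: (measurableT_comp mh measurable_init_coords).
have p101 z : 0 <= p1 z <= 1.
  by rewrite /p1 !indicE; case: (_ \in B); case: (_ \in G);
    rewrite ?mul1r ?mul0r ?lexx ?ler01.
have p201 z : 0 <= p2 z <= 1.
  by rewrite /p2 indicE; case: (_ \in B); rewrite ?mul1r ?mul0r ?h01 ?lexx ?ler01.
have b1 : bmf (fun w => p1 (Z j w) * \1_O w).
  apply: bmfM; last exact: bmf_indic.
  by apply: bmf_comp; [exact: bmf01|exact: measurable_funPT].
have b2 : bmf (fun w => p2 (Z j w) * \1_O w).
  apply: bmfM; last exact: bmf_indic.
  by apply: bmf_comp; [exact: bmf01|exact: measurable_funPT].
have -> : (fun w => \1_(X j @^-1` B `&` O) w * noise j w) =
    (fun w => p1 (Z j w) * \1_O w - p2 (Z j w) * \1_O w).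
  apply/funext => w; rewrite indicI /p1 /p2 /noise /=.
  rewrite (_ : \1_(X j @^-1` B) w = \1_B (init_coords (Z j w)))//; ring.
have e (p : d.+1.-tuple R -> R) : measurable_fun setT p ->
    (forall z, 0 <= p z <= 1) ->
    Ex P (fun w => p (Z j w) * \1_O w) = Ex P (fun w => p (Z 0%N w)) * fine (P O).
  move=> mp p01.
  have ind D (mD : measurable D) := indep_others hZ hZU n j mC sS mD.
  rewrite (Ex_indep_set _ mO ind mp p01)//.
  congr (_ * _); apply: (@Ex_identically_distributed _ _ _ P _ _ (fun k => Z k)) => //.
  by move=> k D mD; exact: iid_identical.
by rewrite ExB// (e p1)// (e p2)// /p1 /p2 hG// subrr.
Qed.

Lemma Ex_noise_sigma n j E : <<s pi_sets n j >> E ->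
  Ex P (fun w => \1_E w * noise j w) = 0.
Proof.
apply: Ex_eq0_sigma.
- exact: pi_setsI.
- exact: pi_setsT.
- exact: pi_sets_measurable.
- exact: bmf_noise.
- exact: Ex_noise_pi.
Qed.

Lemma sigma_pi_sets_measurable n j E : <<s pi_sets n j >> E -> measurable E.
Proof.
move: E; apply: smallest_sub; first exact: sigma_algebra_measurable.
exact: pi_sets_measurable.
Qed.

Lemma measurable_Z_pi n j i : (i < n)%N -> i != j ->
  @measurable_fun _ _ (g_sigma_algebraType (pi_sets n j)) _ setT (Z i).
Proof.
move=> iN ij _ C mC; rewrite setTI; apply: sub_sigma_algebra.
exists setT, (fun k => if k == i then C else setT), setT; split => //.
- by move=> k; case: ifP.
- exact: sigma_processT.
- apply/seteqP; split => w /=.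
    move=> Cw; split => //; split => //.
    by move=> k _ _; case: eqP => // ->.
  by move=> [_ [hh _]]; have := hh i iN ij; rewrite eqxx.
Qed.

Lemma measurable_X_pi n j i : (i < n)%N ->
  @measurable_fun _ _ (g_sigma_algebraType (pi_sets n j)) _ setT (X i).
Proof.
move=> iN; have [->|ij] := eqVneq i j.
  move=> _ B mB; rewrite setTI; apply: sub_sigma_algebra.
  exists B, (fun=> setT), setT; split => //; first exact: sigma_processT.
  by apply/seteqP; split => w //= [].
exact: (measurableT_comp measurable_init_coords (measurable_Z_pi iN ij)).
Qed.

Lemma measurable_U_pi n j k :
  @measurable_fun _ _ (g_sigma_algebraType (pi_sets n j)) _ setT (U k).
Proof.
move=> _ B mB; rewrite setTI; apply: sub_sigma_algebra.
exists setT, (fun=> setT), (U k @^-1` B); split => //.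
  by apply: sub_sigma_algebra; exists k => //; exists B => //; rewrite setTI.
by apply/seteqP; split => w //= [_ []].
Qed.

(** [noise m] is a function of [Z m], which is measurable for the sigma-algebra of [pi_sets n j].
    Its indicator half turns [E] into another event of that sigma-algebra; its [h] half is removed
    by [Ex_agree] against the zero weight. *)
Lemma Ex_noise_noise n j m E : (m < n)%N -> m != j -> <<s pi_sets n j >> E ->
  Ex P (fun w => \1_E w * (noise j w * noise m w)) = 0.
Proof.
move=> mn mj sE; have mE := sigma_pi_sets_measurable sE.
have bE : bmf (\1_E : Omega -> R) by exact: bmf_indic.
have sI A : measurable A -> <<s pi_sets n j >> (E `&` Z m @^-1` A).
  move=> mA; apply: (@measurableI _ (g_sigma_algebraType (pi_sets n j))) => //.
  have := measurable_Z_pi mn mj.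
  by move=> /(_ measurableT A mA); rewrite setTI.
have -> : (fun w => \1_E w * (noise j w * noise m w)) = (fun w =>
   \1_(E `&` Z m @^-1` G) w * noise j w - h (X m w) * (\1_E w * noise j w)).
  apply/funext => w; rewrite indicI /= {2}/noise.
  rewrite (_ : \1_(Z m @^-1` G) w = \1_G (Z m w))//; ring.
rewrite ExB; last 2 first.
- apply: bmfM; last exact: bmf_noise.
  by apply: bmf_indic; apply: sigma_pi_sets_measurable (sI _ mG).
- by apply: bmfM; [exact: bmf_hX|apply: bmfM => //; exact: bmf_noise].
rewrite (Ex_noise_sigma (sI _ mG)) sub0r.
rewrite (@Ex_agree _ _ _ _ _ P _ _ P (X m) (X m) _ (fun=> 0))//.
- rewrite (_ : (fun _ => _) = fun=> 0) ?Ex_cst ?oppr0//.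
  by apply/funext => w; rewrite mulr0.
- exact: measurable_X.
- exact: measurable_X.
- by apply: bmfM => //; exact: bmf_noise.
- exact: bmf_cst.
- move=> B mB; rewrite (_ : (fun x => _ * 0) = fun=> 0) ?Ex_cst; last first.
    by apply/funext => w; rewrite mulr0.
  rewrite -[RHS](Ex_noise_sigma (sI (init_coords @^-1` B) _)); last first.
    by rewrite -[Y in measurable Y]setTI; exact: measurable_init_coords.
  congr Ex; apply/funext => w; rewrite indicI /= mulrA; congr (_ * _).
  by rewrite mulrC.
Qed.

End mean_zero_noise.

Lemma nn_ltn (R : realType) d (x : nat -> d.-tuple R) u n k :
  (k < n)%N -> (nn x u n k < n)%N.
Proof.
move=> kn; have [n2|n1] := leqP 2 n; first exact: nn_lt.
(* Only [n = 1], [k = 0] is left: the list of neighbours is empty and the default value [k] is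
   returned. *)
have -> : n = 1%N by case: n n1 kn => [|[|n]].
have -> : k = 0%N by case: n n1 kn => [|[|n]] // _; case: k.
have s0 : nn_seq x 1 0 = [::] by [].
by rewrite /nn s0 nth_nil.
Qed.

(** * Second moment of the noise along nearest neighbours *)

Section second_moment.
Context {disp : measure_display} {Omega : measurableType disp} {R : realType}.
Context (P : probability Omega R) {d : nat}.
Context (Z : nat -> {RV P >-> d.+1.-tuple R}) (U : nat -> {RV P >-> R}).
Hypotheses (hZ : iid Z) (hZU : independent_processes Z U).
Context (F G : set (d.+1.-tuple R)) (h : d.-tuple R -> R).
Hypotheses (mF : measurable F) (mG : measurable G).
Hypotheses (mh : measurable_fun setT h) (h01 : forall x, 0 <= h x <= 1).
Hypothesis hG : forall B, measurable B ->
  Ex P (fun w => \1_B (init_coords (Z 0%N w)) * \1_G (Z 0%N w)) =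
  Ex P (fun w => \1_B (init_coords (Z 0%N w)) * h (init_coords (Z 0%N w))).

Let X k w := init_coords (Z k w).

Hypothesis distinct :
  {ae P, forall w, forall k l, k != l -> X k w != X l w}.

Definition NN n k w := nn (X ^~ w) (U ^~ w) n k.

Let eps j w : R := noise Z G h j w.

Definition nn_noise n w : R := \sum_(k < n) \1_F (Z k w) * eps (NN n k w) w.

Lemma measurable_NN n k j : (k < n)%N -> measurable [set w | NN n k w = j].
Proof.
move=> kn; apply: (dmeas_nn _ _ kn); first by move=> i _; exact: measurable_X.
by move=> i; exact: measurable_funPT.
Qed.

(** The event on which the summands [k] and [l] of [nn_noise] multiply to [eps j * eps m]; fixing
    the neighbour indices makes the noise indices deterministic. *)
Definition nn_event n k l j m : set Omega :=
  [set w | NN n k w = j] `&` [set w | NN n l w = m] `&`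
  (Z k @^-1` F `&` Z l @^-1` F).

Lemma measurable_nn_event n k l j m : (k < n)%N -> (l < n)%N ->
  measurable (nn_event n k l j m).
Proof.
move=> kn ln; apply: measurableI; apply: measurableI; try exact: measurable_NN;
  exact: measurable_RV_preimage.
Qed.

Let bmf_eps j : bmf (eps j).
Proof. exact: bmf_noise. Qed.

Let eps_le1 j w : `|eps j w| <= 1.
Proof. exact: noise_le1. Qed.

(** For [j = k] the event is empty, a point not being its own neighbour. Otherwise [k] and [l]
    differ from [j], so the event does not involve the response of [j] and belongs to the
    sigma-algebra of [pi_sets n j]. *)
Lemma Ex_nn_event n k l j m : (2 <= n)%N -> (k < n)%N -> (l < n)%N ->
  (m < n)%N -> j != l -> m != j ->
  Ex P (fun w => \1_(nn_event n k l j m) w * (eps j w * eps m w)) = 0.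
Proof.
move=> n2 kn ln mn jl mj; have [jk|jk] := eqVneq j k.
  rewrite (_ : (fun _ => _) = fun=> 0) ?Ex_cst//; apply/funext => w.
  rewrite indicE memNset ?mul0r// => -[[/= Nk _] _].
  have /is_nnP[] := nn_is_nn (X ^~ w) (U ^~ w) n2 kn.
  by rewrite -/(NN n k w) Nk jk eqxx.
apply: (Ex_noise_noise hZ hZU mG mh h01 hG mn mj).
have mNN i i' : (i < n)%N ->
    (pi_sets Z U n j).-sigma.-measurable [set w | NN n i w = i'].
  move=> iN; apply: (@dmeas_nn _ (g_sigma_algebraType (pi_sets Z U n j)) R d
    X (fun k => U k) n _ _ i iN).
    by move=> i'' i''N; exact: measurable_X_pi.
  by move=> i''; exact: measurable_U_pi.
have mZF i : (i < n)%N -> i != j ->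
    (pi_sets Z U n j).-sigma.-measurable (Z i @^-1` F).
  move=> iN ij; have := measurable_Z_pi (Z := Z) (U := U) iN ij.
  by move=> /(_ measurableT F mF); rewrite setTI.
apply: (@measurableI _ (g_sigma_algebraType (pi_sets Z U n j))).
  by apply: (@measurableI _ (g_sigma_algebraType (pi_sets Z U n j))); exact: mNN.
by apply: (@measurableI _ (g_sigma_algebraType (pi_sets Z U n j))); apply: mZF => //;
  rewrite eq_sym.
Qed.

Lemma bmf_nn_noise n : bmf (nn_noise n).
Proof.
(* The random index is resolved by summing over its possible values. *)
rewrite /nn_noise (_ : (fun _ => _) = fun w => \sum_(k < n) \sum_(j < n)
    \1_[set w | NN n k w = j] w * (\1_F (Z k w) * eps j w)).
  apply: bmf_sum => k; apply: bmf_sum => j; apply: bmfM.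
    by apply: bmf_indic; exact: measurable_NN.
  apply: bmfM => //.
  by apply: bmf_comp; [exact: bmf_indic|exact: measurable_funPT].
apply/funext => w; apply: eq_bigr => k _.
rewrite (bigD1 (Ordinal (nn_ltn (X ^~ w) (U ^~ w) (ltn_ord k))))//= big1 => [|j jN].
  by rewrite addr0 [X in _ = X * _]indic_in// mul1r.
rewrite indicE memNset ?mul0r//= => Nj; move/eqP: jN; apply.
by apply/val_inj; rewrite /= -Nj.
Qed.

(** The centred part of [nn_noise n w ^+ 2], with both neighbour indices expanded over their values
    [j] and [m]. *)
Definition off_diag n w : R :=
  \sum_(k < n) \sum_(l < n) \sum_(j < n) \sum_(m < n)
    ((j != l) && (m != j))%:R *
    (\1_(nn_event n k l j m) w * (eps j w * eps m w)).

Let bmf_event n (k l j m : 'I_n) :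
  bmf (fun w => \1_(nn_event n k l j m) w * (eps j w * eps m w)).
Proof.
apply: bmfM; last exact: bmfM.
by apply: bmf_indic; exact: measurable_nn_event.
Qed.

Let bmf_cevent n (k l j m : 'I_n) (c : R) :
  bmf (fun w => c * (\1_(nn_event n k l j m) w * (eps j w * eps m w))).
Proof. by apply: bmfM; [exact: bmf_cst|exact: bmf_event]. Qed.

Lemma bmf_off_diag n : bmf (off_diag n).
Proof.
by apply: bmf_sum => k; apply: bmf_sum => l; apply: bmf_sum => j;
  apply: bmf_sum => m; exact: bmf_cevent.
Qed.

Lemma Ex_off_diag n : (2 <= n)%N -> Ex P (off_diag n) = 0.
Proof.
move=> n2; rewrite Ex_sum; last first.
  by move=> k; apply: bmf_sum => l; apply: bmf_sum => j; apply: bmf_sum => m;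
    exact: bmf_cevent.
apply: big1 => k _; rewrite Ex_sum; last first.
  by move=> l; apply: bmf_sum => j; apply: bmf_sum => m; exact: bmf_cevent.
apply: big1 => l _; rewrite Ex_sum; last first.
  by move=> j; apply: bmf_sum => m; exact: bmf_cevent.
apply: big1 => j _; rewrite Ex_sum; last by move=> m; exact: bmf_cevent.
apply: big1 => m _; rewrite ExZ//.
have [/andP[jl mj]|] := boolP ((j != l) && (m != j)); last by rewrite mul0r.
by rewrite Ex_nn_event// mulr0.
Qed.

Lemma indicF01 k w : 0 <= (\1_F (Z k w) : R) <= 1.
Proof. by rewrite indicE; case: (_ \in _); rewrite ?lexx ler01. Qed.

(** Only [j = N(k)], [m = N(l)] contributes to the double sum, and that term is the product itself
    unless [N(k) = l] or [N(l) = N(k)]; in these cases the product is at most 1. *)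
Lemma nn_product_le n (k l : 'I_n) w :
  (\1_F (Z k w) * eps (NN n k w) w) * (\1_F (Z l w) * eps (NN n l w) w) <=
  (NN n k w == l)%:R + (NN n l w == NN n k w)%:R +
  \sum_(j < n) \sum_(m < n) ((j != l) && (m != j))%:R *
    (\1_(nn_event n k l j m) w * (eps j w * eps m w)).
Proof.
pose j0 := Ordinal (nn_ltn (X ^~ w) (U ^~ w) (ltn_ord k)).
pose m0 := Ordinal (nn_ltn (X ^~ w) (U ^~ w) (ltn_ord l)).
have z j m : (j, m) != (j0, m0) -> \1_(nn_event n k l j m) w = 0 :> R.
  move=> jm; rewrite indicE memNset//= => -[[/= Nj Nm] _]; move/eqP: jm; apply.
  by congr (_, _); apply/val_inj; rewrite /= -?Nj -?Nm.
rewrite (bigD1 j0)// [X in _ + (_ + X)]big1 ?addr0; last first.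
  move=> j jj0; apply: big1 => m _; rewrite z ?mul0r ?mulr0//.
  by apply: contra jj0 => /eqP[->].
rewrite (bigD1 m0)// [X in _ + (_ + X)]big1 ?addr0; last first.
  move=> m mm0; rewrite z ?mul0r ?mulr0//.
  by apply: contra mm0 => /eqP[->].
have -> : \1_(nn_event n k l j0 m0) w = \1_F (Z k w) * \1_F (Z l w) :> R.
  rewrite /nn_event 2!indicI /= indicI /=.
  by rewrite [X in X * _ * _]indic_in// [X in _ * X * _]indic_in// !mul1r.
have E1 : NN n k w = j0 by [].
have E2 : NN n l w = m0 by [].
rewrite E1 E2 -!val_eqE; set p := _ * _.
have p1 : p <= 1.
  rewrite (le_trans (ler_norm _))// /p !normrM.
  have n1 i : `|\1_F (Z i w)| <= 1 :> R.
    by have /andP[? ?] := indicF01 i w; rewrite ger0_norm.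
  by rewrite !mulr_ile1// !mulr_ge0.
have [jl|jl] := eqVneq (val j0) (val l) => /=.
  by rewrite mul0r addr0 (le_trans p1)// lerDl.
have [mj|mj] := eqVneq (val m0) (val j0) => /=.
  by rewrite mul0r addr0 add0r.
by rewrite !add0r mul1r /p [X in _ <= X]mulrACA.
Qed.

(** For each [k] there is one [l] with [N(k) = l], and at most [kissing_bound d] many [l] share the
    neighbour [N(k)]. *)
Lemma nn_noise_sq_le n w : (2 <= n)%N ->
  (forall k l, k != l -> X k w != X l w) ->
  nn_noise n w ^+ 2 <= (1 + (kissing_bound d)%:R) * n%:R + off_diag n w.
Proof.
move=> n2 inj; rewrite expr2 /nn_noise mulr_suml.
rewrite (eq_bigr (fun k : 'I_n => \sum_(l < n) (\1_F (Z k w) * eps (NN n k w) w) *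
  (\1_F (Z l w) * eps (NN n l w) w))); last by move=> k _; rewrite mulr_sumr.
apply: (@le_trans _ _ (\sum_(k < n) (((1 : nat) + kissing_bound d)%:R +
    \sum_(l < n) \sum_(j < n) \sum_(m < n) ((j != l) && (m != j))%:R *
    (\1_(nn_event n k l j m) w * (eps j w * eps m w))))); last first.
  by rewrite big_split /= sumr_const card_ord natrD -[_ *+ n]mulr_natr.
apply: ler_sum => k _.
rewrite (le_trans (ler_sum _ (fun l _ => nn_product_le k l w)))//.
rewrite big_split /= lerD2r big_split /= natrD lerD//.
  rewrite -natr_sum ler_nat.
  rewrite (bigD1 (Ordinal (nn_ltn (X ^~ w) (U ^~ w) (ltn_ord k))))//= eqxx.
  rewrite big1// => l; rewrite -val_eqE /= eq_sym => /negbTE.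
  by rewrite -/(NN n k w) => ->.
rewrite -natr_sum ler_nat.
have := kissing (nn_ltn (X ^~ w) (U ^~ w) (ltn_ord k)) (x := X ^~ w).
move=> /(_ _) /(leq_trans _); apply; last by move=> *; exact: inj.
apply: leq_sum => l _; rewrite -/(NN n k w); case: eqP => // <-.
by rewrite nn_is_nn.
Qed.

(** The new summand contributes at most 1. An old one changes, by at most 2, only if the new point
    is among its nearest neighbours, which happens at most [kissing_bound d] times. *)
Lemma nn_noise_step n w : (forall k l, k != l -> X k w != X l w) ->
  `|nn_noise n.+1 w - nn_noise n w| <= 1 + 2 * (kissing_bound d)%:R.
Proof.
move=> inj; rewrite /nn_noise big_ord_recr /= addrAC -sumrB addrC.
have f1 k c : `|c| <= 1 -> `|\1_F (Z k w) * c| <= 1.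
  move=> c1; rewrite normrM mulr_ile1//.
  by have /andP[? ?] := indicF01 k w; rewrite ger0_norm.
rewrite (le_trans (ler_normD _ _))// lerD//; first exact: f1.
rewrite (le_trans (ler_norm_sum _ _ _))//.
apply: (@le_trans _ _ (\sum_(k < n) 2 * (is_nn (X ^~ w) n.+1 k n)%:R)).
  apply: ler_sum => k _; rewrite -mulrBr.
  have [//|nnn] := boolP (is_nn _ _ _ _); last first.
    by rewrite /NN nn_step// subrr mulr0 normr0 mulr0.
  rewrite mulr1 mulrBr (le_trans (ler_normB _ _))// (_ : 2 = 1 + 1)//.
  by rewrite lerD ?f1.
rewrite -mulr_sumr ler_wpM2l// -natr_sum ler_nat.
have := kissing (ltnSn n) (x := X ^~ w).
move=> /(_ _) /(leq_trans _); apply; last by move=> *; exact: inj.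
by rewrite big_ord_recr /= leq_addr.
Qed.

Lemma ae_smallo_nn_noise : {ae P, forall w, smallo (nn_noise ^~ w)}.
Proof.
apply: (@ae_smallo_of_second_moment _ _ _ _ _ (1 + 2 * (kissing_bound d)%:R)).
- exact: bmf_nn_noise.
- move=> n; have C0 : 0 <= (kissing_bound d)%:R :> R by [].
  have n0 : 0 <= n%:R :> R by [].
  have bsq : bmf (fun w => nn_noise n w ^+ 2).
    rewrite (_ : (fun _ => _) = fun w => nn_noise n w * nn_noise n w).
      by apply: bmfM; exact: bmf_nn_noise.
    by apply/funext => w; rewrite expr2.
  have [n2|n1] := leqP 2 n.
    apply: (@le_trans _ _ ((1 + (kissing_bound d)%:R) * n%:R)); last first.
      by rewrite ler_wpM2r// lerD2l ler_peMl// ler1n.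
    rewrite -[X in _ <= X]addr0 -(Ex_off_diag n2) -[X in _ <= X + _](Ex_cst P).
    rewrite -ExD; [|exact: bmf_cst|exact: bmf_off_diag].
    apply: le_Ex_ae => //.
      by apply: bmfD; [exact: bmf_cst|exact: bmf_off_diag].
    by move: distinct; apply: filterS => w; exact: nn_noise_sq_le.
  (* For [n <= 1] there are no neighbours; the crude bound [|nn_noise n w| <= n] suffices, because
     [n^2 <= n]. *)
  apply: (@le_trans _ _ n%:R); last by rewrite ler_peMl// lerDl mulr_ge0.
  rewrite -(Ex_cst P n%:R); apply: le_Ex => //; first exact: bmf_cst.
  move=> w; rewrite -real_normK ?num_real//.
  have : `|nn_noise n w| <= n%:R.
    rewrite (le_trans (ler_norm_sum _ _ _))//.
    rewrite (@le_trans _ _ (\sum_(k < n) 1))//; last by rewrite sumr_const card_ord.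
    apply: ler_sum => k _; rewrite normrM mulr_ile1//.
    by have /andP[? ?] := indicF01 k w; rewrite ger0_norm.
  case: n n1 {n0 bsq} => [|[|n]] // _ h1; last by rewrite expr_le1.
  by rewrite expr2 (le_trans (ler_wpM2l _ h1))// mulr0.
- by move: distinct; apply: filterS => w inj n; exact: nn_noise_step.
Qed.

End second_moment.

(** * Stability of averages under passing to the nearest neighbour *)

(** [a j] occurs once for each [k] with neighbour [j]. The successor makes the constant visibly at
    least 1, as the case [n <= 1] requires, where the neighbour of [k] is [k]. *)
Lemma sum_nn_le (R : realType) d (x : nat -> d.-tuple R) u n (a : nat -> R) :
  (forall k, 0 <= a k) ->
  (forall k l, (k < n)%N -> (l < n)%N -> k != l -> x k != x l) ->
  \sum_(k < n) a (nn x u n k) <= (kissing_bound d).+1%:R * \sum_(j < n) a j.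
Proof.
move=> a0 inj; have s0 : 0 <= \sum_(j < n) a j by apply: sumr_ge0.
have [n2|n1] := leqP 2 n; last first.
  apply: (@le_trans _ _ (\sum_(j < n) a j)); last by rewrite ler_peMl// ler1n.
  apply: ler_sum => k _; suff -> : nn x u n k = k by [].
  have := nn_ltn x u (ltn_ord k); have := ltn_ord k.
  by case: n n1 k {inj s0} => [|[|n]] // _ k; rewrite !ltnS !leqn0 => /eqP -> /eqP ->.
apply: (@le_trans _ _ (\sum_(j < n) \sum_(k < n) (is_nn x n k j)%:R * a j)).
  rewrite exchange_big /=; apply: ler_sum => k _.
  rewrite (bigD1 (Ordinal (nn_ltn x u (ltn_ord k))))//= nn_is_nn// mul1r lerDl.
  by apply: sumr_ge0 => j _; rewrite mulr_ge0.
rewrite mulr_sumr; apply: ler_sum => j _; rewrite -mulr_suml ler_wpM2r//.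
rewrite -natr_sum ler_nat (leq_trans (kissing (ltn_ord j) inj))//.
Qed.

(** The coordinates are measurable for [S], hence so is the identity map into the tuples. *)
Lemma tuple_sigma_algebra (R : realType) d (S : set (set (d.-tuple R))) :
  sigma_algebra setT S -> (forall i b, S [set x : d.-tuple R | coord i x <= b]) ->
  measurable `<=` S.
Proof.
move=> sS hS B mB.
have E : S.-sigma.-measurable = S by exact: measurable_g_measurableTypeE.
have mc i : @measurable_fun _ _ (g_sigma_algebraType S) _ setT (coord i).
  apply: (measurability _ (RGenOInfty.measurableE R)) => //.
  move=> /= _ [_ [a ->] <-]; rewrite setTI.
  have -> : coord i @^-1` `]a, +oo[ = ~` [set x : d.-tuple R | coord i x <= a].
    apply/seteqP; split => x /=; rewrite in_itv /= andbT ltNge; first by move/negP.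
    by move=> /negP.
  rewrite E -setTD; have [_ + _] := sS; apply; exact: hS.
have mid : @measurable_fun _ _ (g_sigma_algebraType S) (d.-tuple R) setT id.
  by apply/measurable_fun_tnthP => i; exact: mc.
by have := mid measurableT B mB; rewrite setTI E.
Qed.

Section stability.
Context {disp : measure_display} {Omega : measurableType disp} {R : realType}.
Context (P : probability Omega R) {d : nat}.
Context (Z : nat -> {RV P >-> d.+1.-tuple R}) (U : nat -> Omega -> R).
Hypotheses (hZ : iid Z).

Let X k w := init_coords (Z k w).
Let N n k w := nn (X ^~ w) (U ^~ w) n k.

Hypothesis distinct : {ae P, forall w, forall k l, k != l -> X k w != X l w}.
Hypothesis no_atom : forall (i : 'I_d) (b e : R), 0 < e -> exists p : nat,
  fine (P [set w | `|coord i (X 0%N w) - b| <= p.+1%:R^-1]) <= e.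

Lemma slln_set (B : set (d.-tuple R)) : measurable B ->
  {ae P, forall w, smallo (fun n =>
    \sum_(k < n) \1_B (X k w) - n%:R * fine (P (X 0%N @^-1` B)))}.
Proof.
move=> mB.
have mp : measurable_fun setT (fun z : d.+1.-tuple R => \1_B (init_coords z) : R).
  exact: (measurableT_comp (measurable_indic mB) measurable_init_coords).
have p01 (z : d.+1.-tuple R) : 0 <= (\1_B (init_coords z) : R) <= 1.
  by rewrite indicE; case: (_ \in _); rewrite ?lexx ler01.
have := @slln _ _ _ P _ _ (fun k => Z k) _ _ _ _ mp p01.
have -> : Ex P (fun w => \1_B (init_coords (Z 0%N w))) = fine (P (X 0%N @^-1` B)).
  rewrite -Ex_indic//; rewrite -[Y in measurable Y]setTI; exact: measurable_X.
apply => //.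
- by move=> k l kl C D; exact: iid_indep_pair.
- by move=> k C; exact: iid_identical.
Qed.

Definition far_count p n w : R :=
  \sum_(k < n) (p.+1%:R ^- 2 < sqdist (X k w) (X (N n k w) w))%R%:R.

Lemma measurable_in_box M : measurable [set a : d.-tuple R | in_box M a].
Proof.
rewrite (_ : [set a | _] = \bigcap_(i in [set: 'I_d])
    (fun a => `|coord i a|) @^-1` `]-oo, M%:R]).
  apply: fin_bigcap_measurable => // i _; rewrite -[Y in measurable Y]setTI.
  have mn : measurable_fun setT (fun a : d.-tuple R => `|coord i a|).
    exact: (measurableT_comp _ (measurable_coord i)).
  by apply: mn.
apply/seteqP; split => a /=.
  by move=> /forallP aM i _; rewrite /= in_itv /= aM.
by move=> aM; apply/forallP => i; have := aM i I; rewrite /= in_itv.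
Qed.

Lemma out_box_small e : 0 < e -> exists M,
  fine (P (X 0%N @^-1` [set a | ~~ in_box M a])) <= e.
Proof.
move=> e0.
have mX0 B : measurable B -> measurable (X 0%N @^-1` B).
  by move=> mB; rewrite -[Y in measurable Y]setTI; exact: measurable_X.
have [||M hM] := @prob_bigcup_approx _ _ _ P
    (fun M => X 0%N @^-1` [set a | in_box M a]) e _ _ e0.
- by move=> M; apply: mX0; exact: measurable_in_box.
- move=> M M' MM' w /= /forallP h; apply/forallP => i.
  by rewrite (le_trans (h i))// ler_nat.
exists M; rewrite (le_trans _ hM)//.
rewrite (_ : X 0%N @^-1` _ = \bigcup_k X 0%N @^-1` [set a | in_box k a] `\`
  X 0%N @^-1` [set a | in_box M a])//.
apply/seteqP; split => w /=; last by move=> [_ /negP].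
move=> h; split; last exact/negP.
exists (Num.truncn (\sum_i `|coord i (X 0%N w)|)).+1 => //=.
apply/forallP => i; rewrite (le_trans _ (ltW (truncnS_gt _)))//.
by rewrite (bigD1 i)//= lerDl sumr_ge0.
Qed.

(** Inside a box boundedly many points are far from their neighbour, by [far_nn_bound]; the fraction
    of points outside is at most [e] up to [o(1)]. Boxes of integer size keep the null set
    independent of [e]. *)
Lemma ae_far : {ae P, forall w, forall p, smallo (far_count p ^~ w)}.
Proof.
have mO M : measurable [set a : d.-tuple R | ~~ in_box M a].
  rewrite (_ : [set a | _] = ~` [set a | in_box M a]).
    by apply: measurableC; exact: measurable_in_box.
  by apply/seteqP; split => a /= /negP.
have := ae_foralln (fun M => slln_set (mO M)).
apply: filterS => w h p; apply: smallo_approx => e e0.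
have [M hM] := out_box_small e0.
have D0 : 0 < p.+1%:R ^- 2 :> R by rewrite invr_gt0 exprn_gt0.
have [K hK] := far_nn_bound d M D0.
(* The successor of [K] also covers [n <= 1], where the count is at most 1. *)
exists (fun n => `|\sum_(k < n) \1_[set a | ~~ in_box M a] (X k w) -
    n%:R * fine (P (X 0%N @^-1` [set a | ~~ in_box M a]))| + K.+1%:R).
  by apply: smalloD; [exact: smallo_norm|exact: smallo_cst].
move=> n; rewrite ger0_norm; last by apply: sumr_ge0 => k _.
have [n2|n1] := leqP 2 n; last first.
  rewrite (@le_trans _ _ 1)//.
    rewrite (@le_trans _ _ (\sum_(k < n) 1))//.
      by apply: ler_sum => k _; case: (_ < _).
    by rewrite sumr_const card_ord lern1.
  rewrite addrA -natr1 addrA lerDr !addr_ge0// mulr_ge0// ltW//.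
apply: (@le_trans _ _ (\sum_(k < n) \1_[set a | ~~ in_box M a] (X k w) + K%:R)).
  apply: (@le_trans _ _ (\sum_(k < n) \1_[set a | ~~ in_box M a] (X k w) +
     (\sum_(k < n) (in_box M (X k w) &&
        (p.+1%:R ^- 2 < sqdist (X k w) (X (N n k w) w))%R)%:R))).
    rewrite -big_split /=; apply: ler_sum => k _.
    have [b|b] := boolP (in_box M (X k w)); first by rewrite lerDr indicE.
    by rewrite indic_in//= addr0; case: (_ < _).
  by rewrite lerD2l -natr_sum ler_nat; exact: (hK (X ^~ w) (U ^~ w) n n2).
rewrite -natr1 !addrA -[X in X <= _]addr0 lerD// lerD2r.
set p0 := fine _ in hM *; set S := \sum_(_ < _) _.
have := ler_norm (S - n%:R * p0).
have : n%:R * p0 <= e * n%:R by rewrite mulrC ler_wpM2r.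
by move=> ? ?; lra.
Qed.

Definition mismatch (f : d.-tuple R -> R) n w : R :=
  \sum_(k < n) `|f (X (N n k w) w) - f (X k w)|.

Definition stable (B : set (d.-tuple R)) :=
  measurable B /\ {ae P, forall w, smallo (mismatch \1_B ^~ w)}.

(** A point and its neighbour lie on different sides only if they are far apart or the point is in a
    thin slab around the hyperplane, whose probability is small by [no_atom]. *)
Lemma stable_halfspace i b : stable [set a : d.-tuple R | coord i a <= b].
Proof.
split.
  rewrite (_ : [set a | _] = coord i @^-1` `]-oo, b]).
    by rewrite -[Y in measurable Y]setTI; exact: measurable_coord.
  by apply/seteqP; split => a /=; rewrite in_itv.
pose T p := [set a : d.-tuple R | `|coord i a - b| <= p.+1%:R^-1].
have mT p : measurable (T p).
  rewrite (_ : T p = (fun a => `|coord i a - b|) @^-1` `]-oo, p.+1%:R^-1]).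
    rewrite -[Y in measurable Y]setTI.
    have mn : measurable_fun setT (fun a : d.-tuple R => `|coord i a - b|).
      have mb : measurable_fun setT (fun a : d.-tuple R => coord i a - b).
        by apply: measurable_funB; [exact: measurable_coord|exact: measurable_cst].
      exact: (measurableT_comp _ mb).
    by apply: mn.
  by apply/seteqP; split => a /=; rewrite in_itv.
have := ae_foralln (fun p => slln_set (mT p)).
move: ae_far; apply: filterS2 => w hfar hT; apply: smallo_approx => e e0.
have [p hp] := no_atom i b e0.
exists (fun n => far_count p n w + `|\sum_(k < n) \1_(T p) (X k w) -
    n%:R * fine (P (X 0%N @^-1` (T p)))|).
  by apply: smalloD; [exact: hfar|exact: smallo_norm].
move=> n; rewrite ger0_norm; last by apply: sumr_ge0 => k _.
apply: (@le_trans _ _ (far_count p n w + \sum_(k < n) \1_(T p) (X k w))).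
  rewrite -big_split /=; apply: ler_sum => k _.
  set a := X (N n k w) w; set c := X k w.
  have [far|near] := ltP (p.+1%:R ^- 2) (sqdist c a).
    rewrite (@le_trans _ _ 1)// ?lerDl ?indicE//.
    by do 2 case: (_ \in _); rewrite ?subrr ?sub0r ?subr0 ?normrN ?normr0 ?normr1.
  have ac : `|coord i c - coord i a| <= p.+1%:R^-1.
    rewrite -(@ler_pXn2r _ 2%N) ?nnegrE// real_normK ?num_real// exprVn.
    by rewrite (le_trans _ near)//; exact: sqdist_coord.
  have [Tc|Tc] := pselect (T p c).
    rewrite (indic_in _ Tc) add0r !indicE.
    by do 2 case: (_ \in _); rewrite ?subrr ?sub0r ?subr0 ?normrN ?normr0 ?normr1.
  suff -> : \1_[set a | coord i a <= b] a = \1_[set a | coord i a <= b] c :> R.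
    by rewrite subrr normr0 addr_ge0// indicE.
  have d0 : 0 <= p.+1%:R^-1 :> R by [].
  rewrite !indicE; congr (_%:R); congr nat_of_bool.
  move: Tc; rewrite /T /= => /negP; rewrite -ltNge => cb.
  move: cb ac; rewrite ltr_normr ler_norml => cb /andP[a1 a2].
  by apply/idP/idP; rewrite !inE /=; move: d0 cb a1 a2; set dl := p.+1%:R^-1;
    move: dl (coord i c) (coord i a) => dl y z d0 cb a1 a2 ?; case/orP: cb => ?; lra.
set p0 := fine _; have -> : p0 = fine (P [set w | `|coord i (X 0%N w) - b| <= p.+1%:R^-1]) by [].
set S := \sum_(_ < _) \1_(T p) _; set p1 := fine _ in hp *.
have := ler_norm (S - n%:R * p1).
have : n%:R * p1 <= e * n%:R by rewrite mulrC ler_wpM2r.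
by move=> ? ?; lra.
Qed.

Lemma stableC B : stable B -> stable (~` B).
Proof.
move=> [mB sB]; split; first exact: measurableC.
move: sB; apply: filterS => w; congr smallo; apply/funext => n.
apply: eq_bigr => k _; rewrite !indicE !in_setC.
by do 2 case: (_ \in _); rewrite /= ?subrr ?sub0r ?subr0 ?normrN.
Qed.

Lemma stable0 : stable set0.
Proof.
split => //; apply: aeW => w; apply: smallo_le (smallo_cst 0) => n.
by rewrite /mismatch big1 ?normr0// => k _; rewrite !indicE !in_set0 subrr normr0.
Qed.

Lemma stableU A B : stable A -> stable B -> stable (A `|` B).
Proof.
move=> [mA sA] [mB sB]; split; first exact: measurableU.
move: sA sB; apply: filterS2 => w sA sB.
apply: smallo_le (smalloD sA sB) => n; rewrite ger0_norm; last first.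
  by apply: sumr_ge0 => k _.
rewrite /mismatch -big_split /=; apply: ler_sum => k _.
rewrite !indicE !in_setU.
do 4 case: (_ \in _); rewrite /= ?subrr ?sub0r ?subr0 ?normrN ?normr1 ?normr0
  ?addr0 ?add0r ?lexx ?ler01//; lra.
Qed.

(** A finite subunion [A m] misses a part of small probability. Few sample points fall into it, and
    by [sum_nn_le] few neighbours do. *)
Lemma stable_bigcup (B : nat -> set (d.-tuple R)) :
  (forall m, stable (B m)) -> stable (\bigcup_m B m).
Proof.
move=> sB; pose A m := \big[setU/set0]_(i < m.+1) B i.
have sA m : stable (A m).
  by rewrite /A; elim/big_ind: _ ; [exact: stable0|exact: stableU|move=> i _; exact: sB].
have UE : \bigcup_m B m = \bigcup_m A m.
  by rewrite -(bigcup_bigsetU_bigcup B).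
rewrite UE; set V := \bigcup_m A m.
have mA m : measurable (A m) by case: (sA m).
have mV : measurable V by exact: bigcup_measurable.
split => //.
have mD m : measurable (V `\` A m) by exact: measurableD.
have h1 := ae_foralln (fun m => (sA m).2).
have h2 := ae_foralln (fun m => slln_set (mD m)).
move: h1 h2 distinct; apply: filterS3 => w w1 w2 inj; apply: smallo_approx => e e0.
(* [(kissing_bound d).+1] pays for the neighbours in the missing part, the further 1 for the points
   themselves. *)
pose c : R := (kissing_bound d).+1%:R + 1.
have c0 : 0 < c by rewrite addr_gt0.
have mX0 S : measurable S -> measurable (X 0%N @^-1` S).
  by move=> mS; rewrite -[Y in measurable Y]setTI; exact: measurable_X.
have ndA : {homo (fun m => X 0%N @^-1` A m) : n m / (n <= m)%N >-> n `<=` m}.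
  move=> m m' mm'; apply: preimage_subset; exact: subset_bigsetU.
have [m hm] := prob_bigcup_approx P (fun m => mX0 _ (mA m)) ndA (divr_gt0 e0 c0).
exists (fun n => mismatch \1_(A m) n w + c * `|\sum_(k < n) \1_(V `\` A m) (X k w) -
   n%:R * fine (P (X 0%N @^-1` (V `\` A m)))|).
  by apply: smalloD; [exact: w1|apply: smalloZ; exact: smallo_norm].
move=> n; rewrite ger0_norm; last by apply: sumr_ge0 => k _.
pose S := \sum_(k < n) (\1_(V `\` A m) (X k w) : R).
apply: (@le_trans _ _ (mismatch \1_(A m) n w + c * S)).
  apply: (@le_trans _ _ (mismatch \1_(A m) n w +
      (\sum_(k < n) \1_(V `\` A m) (X (N n k w) w) + S))).
    rewrite /mismatch /S -!big_split /=; apply: ler_sum => k _.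
    have E a : \1_V a = \1_(A m) a + \1_(V `\` A m) a :> R.
      have [Aa|Aa] := pselect (A m a).
        have Va : V a by exists m.
        by rewrite (indic_in _ Aa) (indic_in _ Va) indic_notin ?addr0// => -[].
      rewrite (indic_notin _ Aa) add0r; have [Va|Va] := pselect (V a).
        by rewrite (indic_in _ Va) indic_in.
      by rewrite (indic_notin _ Va) indic_notin// => -[].
    rewrite !E opprD addrACA (le_trans (ler_normD _ _))// lerD2l.
    rewrite (le_trans (ler_normB _ _))//.
    by rewrite [ `|\1__ _| ]ger0_norm ?[ `|\1__ (X k w)| ]ger0_norm ?indicE.
  rewrite lerD2l /c mulrDl mul1r lerD2r.
  apply: (@sum_nn_le _ _ _ _ _ (fun k => \1_(V `\` A m) (X k w))).
    by move=> k; rewrite indicE.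
  by move=> k l _ _; exact: inj.
have hp : fine (P (X 0%N @^-1` (V `\` A m))) <= e / c.
  by rewrite (le_trans _ hm)// preimage_setD /V preimage_bigcup.
rewrite -/S; set p0 := fine _ in hp *.
rewrite addrCA lerD2l.
have := ler_norm (S - n%:R * p0).
have h3 : n%:R * (c * p0) <= n%:R * e.
  by rewrite ler_wpM2l// mulrC -ler_pdivlMr.
move=> h4; have : c * S <= c * (n%:R * p0 + `|S - n%:R * p0|).
  by rewrite ler_wpM2l ?(ltW c0)// -lerBlDl.
rewrite mulrDr mulrCA => h5; rewrite (le_trans h5)// lerD2r (le_trans h3)//.
by rewrite mulrC.
Qed.

Lemma measurable_stable B : measurable B -> stable B.
Proof.
apply: tuple_sigma_algebra; last exact: stable_halfspace.
split; [exact: stable0| |exact: stable_bigcup].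
by move=> C; rewrite setTD; exact: stableC.
Qed.

Lemma ae_smallo_mismatch (h : d.-tuple R -> R) : measurable_fun setT h ->
  (forall x, 0 <= h x <= 1) -> {ae P, forall w, smallo (mismatch h ^~ w)}.
Proof.
move=> mh h01.
have hL := ae_foralln (fun q => ae_foralln (fun a =>
  (measurable_stable (measurable_level_set mh q a)).2)).
move: hL; apply: filterS => w hL; apply: smallo_approx => e e0.
(* Approximating [h] at the point and at its neighbour costs [2/q <= e] per index. *)
pose q := (Num.truncn (2 / e)).+1.
have q0 : 0 < q%:R :> R by rewrite ltr0n.
exists (fun n => q%:R^-1 * \sum_(a < q) mismatch \1_(level_set h q a) n w).
  by apply: smalloZ; apply: smallo_sum => a; exact: hL.
move=> n; rewrite ger0_norm; last by apply: sumr_ge0 => k _.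
apply: (@le_trans _ _ (\sum_(k < n) (2 / q%:R + q%:R^-1 * \sum_(a < q)
   `|\1_(level_set h q a) (X (N n k w) w) - \1_(level_set h q a) (X k w)|))).
  apply: ler_sum => k _; set x := X (N n k w) w; set y := X k w.
  have hx := level_approxP h01 x (ltn0Sn _ : (0 < q)%N).
  have hy := level_approxP h01 y (ltn0Sn _ : (0 < q)%N).
  have : `|level_approx h q x - level_approx h q y| <= q%:R^-1 * \sum_(a < q)
     `|\1_(level_set h q a) x - \1_(level_set h q a) y|.
    rewrite /level_approx -sumrB mulr_sumr (le_trans (ler_norm_sum _ _ _))//.
    apply: ler_sum => a _; rewrite -mulrBr normrM ger0_norm//.
  move: hx hy; rewrite !ler_norml; set s := q%:R^-1 * _; set lx := level_approx _ _ x.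
  set ly := level_approx _ _ y => /andP[? ?] /andP[? ?] /andP[? ?].
  by apply/andP; split; lra.
rewrite big_split /= sumr_const card_ord -mulr_sumr exchange_big /=.
rewrite lerD2r -[_ *+ n]mulr_natr ler_wpM2r// ler_pdivrMr// mulrC -ler_pdivrMr//.
exact/ltW/truncnS_gt.
Qed.

End stability.

(** * From the copula to the sample *)

Section orthants.
Context (R : realType) (k : nat).

Definition orthants : set (set (k.-tuple R)) := range lower_orthant.

Lemma lower_orthantE (u : k.-tuple R) : lower_orthant u =
  \bigcap_(i in [set: 'I_k]) (coord i @^-1` `]-oo, coord i u]).
Proof.
apply/seteqP; split => x /=; first by move=> h i _; rewrite /= in_itv /= h.
by move=> h i; have := h i I; rewrite /= in_itv.
Qed.

Lemma measurable_lower_orthant (u : k.-tuple R) : measurable (lower_orthant u).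
Proof.
rewrite lower_orthantE; apply: fin_bigcap_measurable => // i _.
by rewrite -[Y in measurable Y]setTI; exact: measurable_coord.
Qed.

Lemma orthants_setI : setI_closed orthants.
Proof.
move=> _ _ [u _ <-] [v _ <-].
exists [tuple Num.min (coord i u) (coord i v) | i < k] => //.
apply/seteqP; split => x /=.
  move=> h; split => i; have := h i; rewrite /coord tnth_mktuple le_min;
    by move=> /andP[].
by move=> [h1 h2] i; rewrite /coord tnth_mktuple le_min [X in X && _]h1 [X in _ && X]h2.
Qed.

Lemma measurable_orthants : measurable `<=` <<s orthants >>.
Proof.
apply: tuple_sigma_algebra; first exact: smallest_sigma_algebra.
move=> i b.
(* A half-space is the union of the orthants whose other corner coordinates tend to infinity. *)
pose u n := [tuple if j == i then b else n%:R | j < k] : k.-tuple R.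
have -> : [set x : k.-tuple R | coord i x <= b] = \bigcup_n lower_orthant (u n).
  apply/seteqP; split => x /=.
    move=> xb; exists (Num.truncn (\sum_j `|coord j x|)).+1 => // j.
    rewrite {2}/coord tnth_mktuple; case: eqP => [->//|_].
    rewrite (le_trans _ (ltW (truncnS_gt _)))// (bigD1 j)//=.
    by rewrite (le_trans (ler_norm _))// lerDl sumr_ge0.
  by move=> [n _ /(_ i)]; rewrite {2}/coord tnth_mktuple eqxx.
apply: (@bigcup_measurable _ (g_sigma_algebraType orthants)) => n _.
by apply: sub_sigma_algebra; exists (u n).
Qed.

Lemma orthants_measure_unique (m1 m2 : probability (k.-tuple R) R) :
  (forall u, m1 (lower_orthant u) = m2 (lower_orthant u)) ->
  forall B, measurable B -> m1 B = m2 B.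
Proof.
move=> h B mB.
have HE : [set X | orthants X /\ X `<=` setT] = orthants.
  by apply/seteqP; split => X; [case|].
have := @g_sigma_algebra_measure_unique_trace _ R (k.-tuple R) orthants setT
  _ _ _ m1 m2; rewrite HE; apply => //.
- by move=> _ [u _ <-]; exact: measurable_lower_orthant.
- exact: orthants_setI.
- exact: etrans (probability_setT m1) (esym (probability_setT m2)).
- by move=> _ [u _ <-]; exact: h.
- by rewrite -ge0_fin_numE// fin_num_measure.
- exact: measurable_orthants.
Qed.

End orthants.

Section uniform_on_unit_interval.
Context (R : realType).

Lemma uniform01E (B : set R) : measurable B ->
  uniform_prob (@ltr01 R) B = lebesgue_measure (B `&` `[0, 1]).
Proof.
move=> mB; rewrite /uniform_prob integral_uniform_pdf.
rewrite (eq_integral (fun=> 1%E)); last first.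
  move=> x; rewrite inE => -[_ /=]; rewrite in_itv /= /uniform_pdf => ->.
  by rewrite subr0 invr1.
by rewrite integral_cst ?mul1e//; exact: measurableI.
Qed.

Lemma uniform01_itv (a c : R) : 0 <= a -> a <= c -> c <= 1 ->
  uniform_prob (@ltr01 R) `[a, c] = (c - a)%:E.
Proof.
move=> a0 ac c1; rewrite uniform01E// (_ : _ `&` _ = `[a, c]%classic).
  rewrite lebesgue_measure_itv /= lte_fin; case: ifPn => [_|]; rewrite ?EFinB//.
  by rewrite -leNgt => ca; rewrite -EFinB (@le_anti _ _ a c) ?ac ?subrr.
apply/seteqP; split => x /=; first by case.
rewrite !in_itv /= => /andP[ax xc]; split; first by rewrite ax.
by rewrite (le_trans a0)// (le_trans xc).
Qed.

Lemma uniform01_le (c : R) : 0 <= c <= 1 ->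
  uniform_prob (@ltr01 R) `]-oo, c] = c%:E.
Proof.
move=> /andP[c0 c1]; rewrite -[c in RHS]subr0 -uniform01_itv// !uniform01E//.
congr lebesgue_measure; apply/seteqP; split => x /=; rewrite !in_itv /=.
  by move=> [xc /andP[x0 x1]]; rewrite x0 xc x1.
by move=> [/andP[x0 xc] xx].
Qed.

Lemma uniform01_lt0 (c : R) : c < 0 -> uniform_prob (@ltr01 R) `]-oo, c] = 0%E.
Proof.
move=> c0; rewrite uniform01E// (_ : _ `&` _ = set0) ?measure0//.
apply/seteqP; split => x //=; rewrite !in_itv /= => -[xc /andP[x0 _]].
by move: (le_lt_trans (le_trans x0 xc) c0); rewrite ltxx.
Qed.

Lemma uniform01_gt1 : uniform_prob (@ltr01 R) `]1, +oo[ = 0%E.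
Proof.
rewrite uniform01E// (_ : _ `&` _ = set0) ?measure0//.
apply/seteqP; split => x //=; rewrite !in_itv /= andbT => -[x1 /andP[_ x1']].
by move: (lt_le_trans x1 x1'); rewrite ltxx.
Qed.

End uniform_on_unit_interval.

(** * The law of the transformed vector *)

Section connecting_law.
Context {disp : measure_display} {Omega : measurableType disp} {R : realType}.
Context (P : probability Omega R) {k : nat} (Z : {RV P >-> k.-tuple R}).
Context (A : copula R k) (hA : connecting_copula Z A).

Lemma margin_cdf01 i x : 0 <= margin_cdf Z i x <= 1.
Proof.
rewrite /margin_cdf fine_ge0 ?cdf_ge0//= -[X in _ <= X]/(fine 1%E).
by apply: fine_le; rewrite ?fin_num_measure// cdf_le1.
Qed.

Lemma margin_cdf_homo i : {homo margin_cdf Z i : x y / x <= y}.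
Proof.
by move=> x y xy; apply: fine_le; rewrite ?fin_num_measure// cdf_nondecreasing.
Qed.

Lemma measurable_margin_cdf i : measurable_fun setT (margin_cdf Z i).
Proof. by apply: nondecreasing_measurable => //; exact: margin_cdf_homo. Qed.

Definition margin_transform (x : k.-tuple R) : k.-tuple R :=
  [tuple margin_cdf Z i (coord i x) | i < k].

Lemma coord_margin_transform i x :
  coord i (margin_transform x) = margin_cdf Z i (coord i x).
Proof. by rewrite {1}/coord tnth_mktuple. Qed.

Lemma measurable_margin_transform : measurable_fun setT margin_transform.
Proof.
apply/measurable_fun_tnthP => i.
rewrite (_ : _ \o _ = margin_cdf Z i \o coord i).
  exact: (measurableT_comp (measurable_margin_cdf i) (measurable_coord i)).
by apply/funext => x /=; exact: coord_margin_transform.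
Qed.

Definition copula_vector (w : Omega) : k.-tuple R := margin_transform (Z w).

Lemma measurable_copula_vector : measurable_fun setT copula_vector.
Proof.
by apply: (measurableT_comp measurable_margin_transform); exact: measurable_funPT.
Qed.

HB.instance Definition _ :=
  isMeasurableFun.Build _ _ _ _ copula_vector measurable_copula_vector.

Lemma unit_cube_margin_transform x : unit_cube (margin_transform x).
Proof. by move=> i; rewrite in_itv /= coord_margin_transform margin_cdf01. Qed.

Lemma copula_orthant_le0 (u : k.-tuple R) i : coord i u < 0 ->
  copula_measure A (lower_orthant u) = 0%E.
Proof.
move=> ui; apply/eqP; rewrite -measure_le0.
rewrite -(uniform01_lt0 ui) -(copula_margins A i)//.
apply: le_measure; rewrite ?inE.
- exact: measurable_lower_orthant.
- by rewrite -[Y in measurable Y]setTI; exact: measurable_coord.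
- by move=> x /(_ i) /=; rewrite in_itv.
Qed.

Lemma copula_cube_le1 : {ae copula_measure A, forall x, forall i, coord i x <= 1}.
Proof.
apply: filter_forall => i; exists (coord i @^-1` `]1, +oo[); split.
- by rewrite -[Y in measurable Y]setTI; exact: measurable_coord.
- by have := copula_margins A i (measurable_itv `]1, +oo[); rewrite uniform01_gt1.
- by move=> x /negP; rewrite -ltNge /= in_itv /= andbT.
Qed.

Lemma prob_ae_eq d (T : measurableType d) (mu : probability T R) (B C : set T) :
  measurable B -> measurable C -> {ae mu, forall x, B x <-> C x} -> mu B = mu C.
Proof.
move=> mB mC BC; rewrite -[LHS]fineK ?fin_num_measure//.
rewrite -[RHS]fineK ?fin_num_measure// -!Ex_indic//; congr EFin.
apply: Ex_ae_eq; [exact: measurable_indic|exact: measurable_indic|].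
move: BC; apply: filterS => x BC; rewrite !indicE; congr (_%:R).
by congr nat_of_bool; apply/idP/idP; rewrite !inE => /BC.
Qed.

(** Orthants determine a law, but the connecting copula is known on the cube only. A negative corner
    coordinate gives mass 0 on both sides, and coordinates above 1 can be lowered to 1 because
    neither law charges values above 1. *)
Lemma copula_vector_law B : measurable B ->
  P (copula_vector @^-1` B) = copula_measure A B.
Proof.
move: B; apply: (@orthants_measure_unique R k (distribution P copula_vector)) => u.
rewrite [LHS]/=.
have [[i ui]|up] := pselect (exists i, coord i u < 0).
  rewrite (copula_orthant_le0 ui) /distribution /pushforward.
  rewrite (_ : _ @^-1` _ = set0) ?measure0//; apply/seteqP; split => w // /(_ i).
  rewrite coord_margin_transform => h; have /andP[h0 _] := margin_cdf01 i (coord i (Z w)).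
  by move: (le_lt_trans (le_trans h0 h) ui); rewrite ltxx.
pose v := [tuple Num.min (coord i u) 1 | i < k] : k.-tuple R.
have vE i : coord i v = Num.min (coord i u) 1 by rewrite {1}/coord tnth_mktuple.
have cv : unit_cube v.
  move=> i; rewrite in_itv /= vE ge_min lexx orbT andbT le_min ler01 andbT.
  by rewrite leNgt; apply/negP => h; apply: up; exists i.
have -> : copula_measure A (lower_orthant u) = copula_measure A (lower_orthant v).
  apply: prob_ae_eq; [exact: measurable_lower_orthant|exact: measurable_lower_orthant|].
  apply: filterS copula_cube_le1 => x x1; split => h i.
    by rewrite vE le_min h x1.
  by have := h i; rewrite vE le_min => /andP[].
rewrite (copula_cdf A cv) (hA cv) fineK; last first.
  rewrite fin_num_measure// (_ : [set w | _] = copula_vector @^-1` lower_orthant v).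
    rewrite -[Y in measurable Y]setTI; apply: measurable_copula_vector => //.
    exact: measurable_lower_orthant.
  by apply/seteqP; split => w h i; have := h i; rewrite coord_margin_transform.
rewrite /distribution /pushforward; congr (P _); apply/seteqP; split => w h i.
  have := h i; rewrite coord_margin_transform vE le_min => ->.
  by have /andP[] := margin_cdf01 i (coord i (Z w)).
have := h i; rewrite coord_margin_transform vE le_min => /andP[].
by move=> ->.
Qed.

Lemma margin_transform_uniform i (B : set R) : measurable B ->
  P [set w | B (margin_cdf Z i (coord i (Z w)))] = uniform_prob (@ltr01 R) B.
Proof.
move=> mB; rewrite -(copula_margins A i)// /distribution /pushforward.
rewrite -copula_vector_law; last first.
  by rewrite -[Y in measurable Y]setTI; exact: measurable_coord.
congr (P _); apply/seteqP; split => w /=; by rewrite coord_margin_transform.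
Qed.

(** The slab is mapped into an interval between two values of the distribution function; the
    transform is uniform, so the probability is at most their difference, which continuity makes
    small. *)
Lemma margin_no_atom i (b e : R) : continuous (margin_cdf Z i) -> 0 < e ->
  exists p : nat, fine (P [set w | `|coord i (Z w) - b| <= p.+1%:R^-1]) <= e.
Proof.
move=> cF e0; have e20 : 0 < e / 2 by rewrite divr_gt0.
have /cvgrPdist_le /(_ _ e20) [r /= r0 hr] := cF b.
exists (Num.truncn r^-1); set dl := _^-1.
have dr : dl < r.
  by rewrite /dl -[X in _ < X]invrK ltf_pV2 ?posrE ?invr_gt0//; exact: truncnS_gt.
have d0 : 0 <= dl by rewrite invr_ge0.
have h1 : `|margin_cdf Z i b - margin_cdf Z i (b - dl)| <= e / 2.
  by apply: hr => /=; rewrite opprB addrCA subrr addr0 ger0_norm.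
have h2 : `|margin_cdf Z i b - margin_cdf Z i (b + dl)| <= e / 2.
  by apply: hr => /=; rewrite opprD addrA subrr sub0r normrN ger0_norm.
have /andP[a0 _] := margin_cdf01 i (b - dl).
have /andP[_ c1] := margin_cdf01 i (b + dl).
have ac : margin_cdf Z i (b - dl) <= margin_cdf Z i (b + dl).
  by apply: margin_cdf_homo; lra.
have mF : measurable_fun setT (fun w => margin_cdf Z i (coord i (Z w))).
  apply: (measurableT_comp (measurable_margin_cdf i)).
  by apply: (measurableT_comp (measurable_coord i)); exact: measurable_funPT.
have mZ : measurable_fun setT (fun w => `|coord i (Z w) - b|).
  have mb : measurable_fun setT (fun w => coord i (Z w) - b).
    apply: measurable_funB; last exact: measurable_cst.
    by apply: (measurableT_comp (measurable_coord i)); exact: measurable_funPT.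
  exact: (measurableT_comp _ mb).
apply: (@le_trans _ _ (fine (P [set w | (`[margin_cdf Z i (b - dl),
   margin_cdf Z i (b + dl)]%classic : set R) (margin_cdf Z i (coord i (Z w)))]))).
  apply: fine_prob_le.
  - rewrite (_ : [set w | _] = (fun w => `|coord i (Z w) - b|) @^-1` `]-oo, dl]).
      by rewrite -[Y in measurable Y]setTI; apply: mZ.
    by apply/seteqP; split => w /=; rewrite in_itv.
  - by rewrite -[Y in measurable Y]setTI; exact: mF.
  - move=> w /=; rewrite ler_norml in_itv /= => /andP[w1 w2].
    by rewrite !margin_cdf_homo//; lra.
rewrite (margin_transform_uniform _ (measurable_itv _)) uniform01_itv//=.
move: h1 h2; rewrite !ler_norml => /andP[? ?] /andP[? ?].
lra.
Qed.

(** The left event is contained in the right one by monotonicity, and both have probability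
    [margin_cdf Z i b]: one by definition, the other because the transform is uniform. *)
Lemma margin_le_ae i b :
  {ae P, forall w, coord i (Z w) <= b <-> margin_cdf Z i (coord i (Z w)) <= margin_cdf Z i b}.
Proof.
pose B := [set w | coord i (Z w) <= b].
pose C := [set w | margin_cdf Z i (coord i (Z w)) <= margin_cdf Z i b].
have mcZ : measurable_fun setT (fun w => coord i (Z w)).
  by apply: (measurableT_comp (measurable_coord i)); exact: measurable_funPT.
have mB : measurable B.
  rewrite (_ : B = (fun w => coord i (Z w)) @^-1` `]-oo, b]).
    by rewrite -[Y in measurable Y]setTI; apply: mcZ.
  by apply/seteqP; split => w /=; rewrite in_itv.
have mC : measurable C.
  rewrite (_ : C = (fun w => margin_cdf Z i (coord i (Z w))) @^-1` `]-oo, margin_cdf Z i b]).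
    rewrite -[Y in measurable Y]setTI.
    by apply: (measurableT_comp (measurable_margin_cdf i) mcZ).
  by apply/seteqP; split => w /=; rewrite in_itv.
have BC : B `<=` C by move=> w; exact: margin_cdf_homo.
have PB : P B = (margin_cdf Z i b)%:E.
  rewrite /margin_cdf fineK; last by rewrite /cdf fin_num_measure.
  transitivity (P ((fun w => coord i (Z w)) @^-1` `]-oo, b])); last by [].
  by congr (P _); apply/seteqP; split => w /=; rewrite in_itv.
have PC : P C = (margin_cdf Z i b)%:E.
  rewrite -uniform01_le ?margin_cdf01//.
  rewrite -(margin_transform_uniform i (measurable_itv `]-oo, margin_cdf Z i b])).
  by congr (P _); apply/seteqP; split => w /=; rewrite in_itv.
exists (C `\` B); split; first exact: measurableD.
  have -> : P (C `\` B) = (P C - P B)%E.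
    rewrite measureD//; last by rewrite -ge0_fin_numE ?fin_num_measure.
    by rewrite setIidr.
  by rewrite PB PC -EFinB subrr.
move=> w /= h; split.
  apply: contrapT => nC; apply: h; split; last by move=> ?; exfalso; exact: nC.
  by move=> wB; exfalso; apply: nC; exact: BC.
by move=> wB; apply: h; split => // _; exact: BC.
Qed.

End connecting_law.

(** * Absence of ties *)

Section distinct_coordinates.
Context {disp : measure_display} {Omega : measurableType disp} {R : realType}.
Context (P : probability Omega R) {d : nat} (Z : nat -> {RV P >-> d.-tuple R}).
Hypothesis hZ : iid Z.
Context (A : copula R d) (hA : connecting_copula (Z 0%N) A).

Let F i (z : d.-tuple R) := margin_cdf (Z 0%N) i (coord i z).

Let mF i : measurable_fun setT (F i).
Proof. exact: (measurableT_comp (measurable_margin_cdf _ i) (measurable_coord i)). Qed.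

(* Two independent uniform variables fall in the same one of [q] intervals of
   length [1/q] with probability [1/q]. *)
Lemma prob_eq_margin i k l q : k != l ->
  fine (P [set w | F i (Z k w) = F i (Z l w)]) <= q.+1%:R^-1.
Proof.
move=> kl; have q0 : 0 < q.+1%:R :> R by [].
(* Closed intervals cover the value 1 as well; their common endpoints do no harm in a union
   bound. *)
pose I a : set R := `[a%:R / q.+1%:R, a.+1%:R / q.+1%:R]%classic.
pose T a := [set z | I a (F i z)].
have mT a : measurable (T a).
  by rewrite -[Y in measurable Y]setTI; apply: (mF i) => //; exact: measurable_itv.
have PT j (a : 'I_q.+1) : P (Z j @^-1` T a) = (q.+1%:R^-1)%:E.
  rewrite (iid_identical hZ)//.
  have := margin_transform_uniform hA i (measurable_itv `[a%:R / q.+1%:R, a.+1%:R / q.+1%:R]).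
  move=> /= ->; rewrite uniform01_itv.
  - by rewrite -mulrBl -natr1 addrC addKr mul1r.
  - by rewrite divr_ge0.
  - by rewrite ler_wpM2r// ler_nat.
  - by rewrite ler_pdivrMr// mul1r ler_nat.
pose E := [set w | F i (Z k w) = F i (Z l w)].
pose B a := Z k @^-1` T a `&` Z l @^-1` T a.
have mB a : measurable (B a).
  by apply: measurableI; exact: measurable_funPTI.
have mE : measurable E.
  have m1 : measurable_fun setT (fun w => F i (Z k w)).
    by apply: (measurableT_comp (mF i)); exact: measurable_funPT.
  have m2 : measurable_fun setT (fun w => F i (Z l w)).
    by apply: (measurableT_comp (mF i)); exact: measurable_funPT.
  have := measurable_fun_eqr m1 m2 => /(_ measurableT [set true]).
  rewrite setTI => /(_ _); rewrite (_ : _ @^-1` _ = E); first exact.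
  by apply/seteqP; split => w /= /eqP.
have EB : E `<=` \big[setU/set0]_(a < q.+1) B a.
  move=> w Ew; have /andP[f0 f1] := margin_cdf01 (Z 0%N) i (coord i (Z k w)).
  pose f := F i (Z k w).
  have [a fa] : exists a : 'I_q.+1, I a f.
    have [fq|fq] := ltP (f * q.+1%:R) q.+1%:R.
      have y0 : 0 <= f * q.+1%:R by rewrite mulr_ge0.
      have /andP[t1 t2] := truncn_itv y0.
      have tq : (Num.truncn (f * q.+1%:R) < q.+1)%N by rewrite truncn_lt_nat.
      exists (Ordinal tq); rewrite /I /= in_itv /= ler_pdivrMr// t1.
      by rewrite ler_pdivlMr// ltW.
    have -> : f = 1.
      apply/le_anti; rewrite f1 /=.
      by move: fq; rewrite -{1}[q.+1%:R]mul1r ler_pM2r.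
    exists ord_max; rewrite /I /= in_itv /= divff ?lexx ?andbT ?gt_eqF//.
    by rewrite ler_pdivrMr// mul1r ler_nat.
  by rewrite -bigcup_mkord; exists a => //=; split => //; rewrite /T /= -Ew.
have h : (P E <= (q.+1%:R^-1)%:E)%E.
  apply: (@le_trans _ _ (P (\big[setU/set0]_(a < q.+1) B a))).
    by rewrite le_measure ?inE//; exact: bigsetU_measurable.
  rewrite (le_trans (Boole_inequality _ _))//.
  rewrite (eq_bigr (fun=> (q.+1%:R^-1 * q.+1%:R^-1)%:E)); last first.
    move=> a _; transitivity (P (Z k @^-1` T a) * P (Z l @^-1` T a))%E.
      exact: (iid_indep_pair hZ kl).
    by rewrite !PT.
  rewrite sumEFin lee_fin sumr_const card_ord -[_ *+ _]mulr_natr.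
  by rewrite mulfVK// gt_eqF.
by rewrite -[X in _ <= X]/(fine (q.+1%:R^-1)%:E) fine_le// ?fin_num_measure.
Qed.

(** Equal coordinates have equal transforms, an event of probability at most [1/(q+1)] for every
    [q]. *)
Lemma ae_distinct_coord i :
  {ae P, forall w, forall k l, k != l -> coord i (Z k w) != coord i (Z l w)}.
Proof.
apply: ae_foralln => k; apply: ae_foralln => l.
have [->|kl] := eqVneq k l; first by apply: aeW => w; rewrite eqxx.
have m1 j : measurable_fun setT (fun w => F i (Z j w)).
  by apply: (measurableT_comp (mF i)); exact: measurable_funPT.
have mE : measurable [set w | F i (Z k w) = F i (Z l w)].
  have := measurable_fun_eqr (m1 k) (m1 l) => /(_ measurableT [set true]).
  rewrite setTI => /(_ _); rewrite (_ : _ @^-1` _ = [set w | F i (Z k w) = F i (Z l w)]).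
    exact.
  by apply/seteqP; split => w /= /eqP.
exists [set w | F i (Z k w) = F i (Z l w)]; split => //.
  rewrite -[LHS]fineK ?fin_num_measure//; congr EFin.
  apply/le_anti/andP; split; last exact: fine_ge0.
  apply/ler_addgt0Pr => e e0; rewrite add0r.
  rewrite (le_trans (prob_eq_margin i (Num.truncn e^-1) kl))//.
  rewrite -[X in _ <= X]invrK lef_pV2 ?posrE ?invr_gt0//.
  exact/ltW/truncnS_gt.
move=> w /= h; rewrite /F; congr margin_cdf; apply/eqP; apply: contrapT => h'.
by apply: h => _; apply/negP.
Qed.

End distinct_coordinates.

(** * Disintegration and the conditional law of the response *)

Section kernel.
Context {R : realType} {d : nat} (A : copula R d.+1).
Context (K : R.-pker (d.-tuple R) ~> R) (hK : is_markov_kernel A K).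

Definition kernel_prob (F : set R) (u : d.-tuple R) : R := fine (K u F).

Lemma kernel_fin_num F u : measurable F -> K u F \is a fin_num.
Proof.
move=> mF; rewrite ge0_fin_numE//; apply: (@le_lt_trans _ _ (K u setT)).
  by rewrite le_measure ?inE.
by rewrite prob_kernel ltry.
Qed.

Lemma kernel_prob01 F u : measurable F -> 0 <= kernel_prob F u <= 1.
Proof.
move=> mF; rewrite /kernel_prob fine_ge0//= -[X in _ <= X]/(fine 1%E).
by rewrite -(prob_kernel (s := K) u) fine_le ?kernel_fin_num// le_measure ?inE.
Qed.

Lemma measurable_kernel_prob F : measurable F -> measurable_fun setT (kernel_prob F).
Proof.
move=> mF; apply/measurable_EFinP.
rewrite (_ : EFin \o _ = K ^~ F); first exact: measurable_kernel.
by apply/funext => u /=; rewrite fineK// kernel_fin_num.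
Qed.

Lemma disintegration (F : set R) (phi : d.-tuple R -> R) : measurable F ->
  measurable_fun setT phi -> (forall u, 0 <= phi u <= 1) ->
  Ex (copula_measure A) (fun v => phi (init_coords v) * \1_F (last_coord v)) =
  Ex (init_margin A) (fun u => phi u * kernel_prob F u).
Proof.
move=> mF mphi phi01.
have mlast : measurable_fun setT (@last_coord R d) by exact: measurable_coord.
have bk : bmf (kernel_prob F).
  by apply: bmf01 => [|u]; [exact: measurable_kernel_prob|exact: kernel_prob01].
apply: (@Ex_agree _ _ _ _ _ (copula_measure A) _ _ (init_margin A) init_coords id) => //.
  by apply: bmf_comp => //; exact: bmf_indic.
move=> E mE.
have mp : measurable (init_coords @^-1` E `&` last_coord @^-1` F).
  by apply: measurableI; rewrite -[Y in measurable Y]setTI;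
    [exact: measurable_init_coords|exact: mlast].
transitivity (fine (copula_measure A (init_coords @^-1` E `&` last_coord @^-1` F))).
  rewrite -Ex_indic//; congr Ex; apply/funext => v.
  by rewrite indicI.
rewrite hK// integral_mkcond; congr fine; apply: eq_integral => u _.
rewrite patchE; have [uE|uE] := boolP (u \in E).
  by rewrite indicE uE mul1r fineK// kernel_fin_num.
by rewrite indicE (negbTE uE) mul0r.
Qed.

End kernel.

Section conditional_law.
Context {disp : measure_display} {Omega : measurableType disp} {R : realType}.
Context (P : probability Omega R) {d : nat} (Z : {RV P >-> d.+1.-tuple R}).
Context (A : copula R d.+1) (hA : connecting_copula Z A).
Context (K : R.-pker (d.-tuple R) ~> R) (hK : is_markov_kernel A K).

Definition init_transform (x : d.-tuple R) : d.-tuple R :=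
  [tuple margin_cdf Z (widen_ord (leqnSn d) i) (coord i x) | i < d].

Lemma coord_init_coords i (z : d.+1.-tuple R) :
  coord i (init_coords z) = coord (widen_ord (leqnSn d) i) z.
Proof. by rewrite {1}/coord tnth_mktuple. Qed.

Lemma init_coords_margin_transform z :
  init_coords (margin_transform Z z) = init_transform (init_coords z).
Proof.
apply: eq_from_tnth => i; rewrite -/(coord i _) coord_init_coords.
by rewrite coord_margin_transform tnth_mktuple coord_init_coords.
Qed.

Lemma measurable_init_transform : measurable_fun setT init_transform.
Proof.
apply/measurable_fun_tnthP => i.
rewrite (_ : _ \o _ = margin_cdf Z (widen_ord (leqnSn d) i) \o coord i).
  exact: (measurableT_comp (measurable_margin_cdf _ _) (measurable_coord i)).
by apply/funext => x /=; rewrite tnth_mktuple.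
Qed.

Definition response_le (t : R) : set (d.+1.-tuple R) :=
  [set z | margin_cdf Z ord_max (last_coord z) <= t].

Lemma measurable_response_le t : measurable (response_le t).
Proof.
rewrite (_ : response_le t =
    (margin_cdf Z ord_max \o last_coord) @^-1` `]-oo, t]).
  rewrite -[Y in measurable Y]setTI.
  by apply: (measurableT_comp (measurable_margin_cdf _ _) (measurable_coord ord_max)).
by apply/seteqP; split => z /=; rewrite in_itv.
Qed.

Lemma indic_response_le t z : \1_(response_le t) z =
  \1_[set` `[0, t]] (last_coord (margin_transform Z z)) :> R.
Proof.
rewrite !indicE; congr (_%:R); congr nat_of_bool.
rewrite /last_coord coord_margin_transform.
have /andP[h0 _] := margin_cdf01 Z ord_max (coord ord_max z).
by apply/idP/idP; rewrite !inE /= in_itv /= ?h0 //.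
Qed.

Lemma prob_response_le t : 0 <= t <= 1 ->
  fine (P [set w | response_le t (Z w)]) = t.
Proof.
move=> t01; have := margin_transform_uniform hA ord_max (measurable_itv `]-oo, t]).
rewrite uniform01_le// (_ : [set w | _] = [set w | response_le t (Z w)]).
  by move=> ->.
by apply/seteqP; split => w /=; rewrite in_itv.
Qed.

(** A version of the conditional probability of [response_le t] given [X = x]: the kernel of [A]
    read at the marginal transform of [x]. *)
Definition cond_prob (t : R) (x : d.-tuple R) : R :=
  kernel_prob K `[0, t] (init_transform x).

Lemma cond_prob01 t x : 0 <= cond_prob t x <= 1.
Proof. exact: kernel_prob01. Qed.

Lemma measurable_cond_prob t : measurable_fun setT (cond_prob t).
Proof.
apply: (measurableT_comp _ measurable_init_transform).
exact: measurable_kernel_prob.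
Qed.

Let X w := init_coords (Z w).
Let V := copula_vector Z.

Lemma Ex_copula_vector (phi : d.+1.-tuple R -> R) : measurable_fun setT phi ->
  (forall v, 0 <= phi v <= 1) ->
  Ex P (fun w => phi (V w)) = Ex (copula_measure A) phi.
Proof.
move=> mphi phi01.
apply: (@Ex_same_law _ _ _ _ _ _ _ P (copula_measure A) V id) => //.
by move=> E mE; exact: (copula_vector_law hA).
Qed.

Lemma Ex_init_copula_vector (phi : d.-tuple R -> R) : measurable_fun setT phi ->
  (forall v, 0 <= phi v <= 1) ->
  Ex P (fun w => phi (init_coords (V w))) = Ex (init_margin A) phi.
Proof.
move=> mphi phi01.
apply: (@Ex_same_law _ _ _ _ _ _ _ P (init_margin A) (fun w => init_coords (V w)) id) => //.
  by apply: (measurableT_comp measurable_init_coords); exact: measurable_copula_vector.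
move=> E mE; rewrite (_ : _ @^-1` E = V @^-1` (init_coords @^-1` E))//.
rewrite (copula_vector_law hA)//.
by rewrite -[Y in measurable Y]setTI; exact: measurable_init_coords.
Qed.

(* Although the margins need not be injective, [X] and its transform generate
   the same sigma-algebra up to null sets. *)
Lemma transform_event B : measurable B -> exists2 B', measurable B' &
  {ae P, forall w, B (X w) <-> B' (init_transform (X w))}.
Proof.
pose S : set (set (d.-tuple R)) := [set B | exists2 B', measurable B' &
  {ae P, forall w, B (X w) <-> B' (init_transform (X w))}].
suff : measurable `<=` S by move=> /(_ B).
apply: tuple_sigma_algebra; first split.
- by exists set0 => //; exact: aeW.
- move=> C [C' mC' CC']; exists (~` C'); first exact: measurableC.
  by rewrite setTD; move: CC'; apply: filterS => w /= ->.
- move=> C sC.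
  have /choice[C' hC'] : forall n, exists C', measurable C' /\
      {ae P, forall w, C n (X w) <-> C' (init_transform (X w))}.
    by move=> n; have [C' mC' h] := sC n; exists C'.
  exists (\bigcup_n C' n); first by apply: bigcup_measurable => n _; case: (hC' n).
  have := ae_foralln (fun n => (hC' n).2); apply: filterS => w h.
  by split => -[n _ hn]; exists n => //; exact/h.
- move=> i b; set j := widen_ord (leqnSn d) i.
  exists [set u : d.-tuple R | coord i u <= margin_cdf Z j b].
    rewrite (_ : [set u | _] = coord i @^-1` `]-oo, margin_cdf Z j b]).
      by rewrite -[Y in measurable Y]setTI; exact: measurable_coord.
    by apply/seteqP; split => u /=; rewrite in_itv.
  have := margin_le_ae hA j b; apply: filterS => w /=.
  by rewrite -init_coords_margin_transform !coord_init_coords coord_margin_transform.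
Qed.

Let bmf_indic_X B : measurable B -> measurable_fun setT (fun w => \1_B (X w) : R).
Proof.
move=> mB; apply: (measurableT_comp (measurable_indic mB)).
by apply: (measurableT_comp measurable_init_coords); exact: measurable_funPT.
Qed.

(** Trading [B] for an event of the transformed vector makes both sides functions of [V], whose law
    is that of [A]; there the defining property of the kernel applies. *)
Lemma cond_probP t B : measurable B ->
  Ex P (fun w => \1_B (X w) * \1_(response_le t) (Z w)) =
  Ex P (fun w => \1_B (X w) * cond_prob t (X w)).
Proof.
move=> mB; have [B' mB' BB'] := transform_event mB.
have mX : measurable_fun setT X.
  by apply: (measurableT_comp measurable_init_coords); exact: measurable_funPT.
have mVi : measurable_fun setT (fun w => init_coords (V w)).
  by apply: (measurableT_comp measurable_init_coords); exact: measurable_copula_vector.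
have mG : measurable_fun setT (fun w => \1_(response_le t) (Z w) : R).
  apply: (measurableT_comp (measurable_indic (measurable_response_le t))).
  exact: measurable_funPT.
have mk : measurable_fun setT (fun w => cond_prob t (X w)).
  exact: (measurableT_comp (measurable_cond_prob t) mX).
have mB'V : measurable_fun setT (fun w => \1_B' (init_coords (V w)) : R).
  exact: (measurableT_comp (measurable_indic mB') mVi).
have EB : {ae P, forall w, \1_B (X w) = \1_B' (init_coords (V w)) :> R}.
  move: BB'; apply: filterS => w BB'; rewrite init_coords_margin_transform.
  rewrite !indicE; congr (_%:R); congr nat_of_bool.
  by apply/idP/idP; rewrite !inE => /BB'.
have i01 (T : Type) (C : set T) x : 0 <= (\1_C x : R) <= 1.
  by rewrite indicE; case: (_ \in _); rewrite ?lexx ler01.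
have mul01 (a b : R) : 0 <= a <= 1 -> 0 <= b <= 1 -> 0 <= a * b <= 1.
  by move=> /andP[a0 a1] /andP[b0 b1]; rewrite mulr_ge0//= mulr_ile1.
have m0t : measurable ([set` `[0, t]] : set R) by [].
transitivity (Ex P (fun w => \1_B' (init_coords (V w)) * \1_(response_le t) (Z w))).
  apply: Ex_ae_eq; [|exact: measurable_funM|].
    by apply: measurable_funM => //; exact: bmf_indic_X.
  by move: EB; apply: filterS => w ->.
transitivity (Ex P (fun w => \1_B' (init_coords (V w)) * cond_prob t (X w))); last first.
  apply: Ex_ae_eq; [exact: measurable_funM| |].
    by apply: measurable_funM => //; exact: bmf_indic_X.
  by move: EB; apply: filterS => w ->.
transitivity (Ex P (fun w => (fun v => \1_B' (init_coords v) *
   \1_[set` `[0, t]] (last_coord v)) (V w))).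
  by congr Ex; apply/funext => w; rewrite indic_response_le.
rewrite (Ex_copula_vector (phi := fun v => \1_B' (init_coords v) *
   \1_[set` `[0, t]] (last_coord v))); last 2 first.
- apply: measurable_funM.
    exact: (measurableT_comp (measurable_indic mB') measurable_init_coords).
  exact: (measurableT_comp (measurable_indic m0t) (measurable_coord ord_max)).
- by move=> v; apply: mul01; exact: i01.
rewrite (disintegration hK m0t)//.
rewrite -(Ex_init_copula_vector (phi := fun u => \1_B' u * kernel_prob K `[0, t] u)).
- by congr Ex; apply/funext => w; rewrite /cond_prob -init_coords_margin_transform.
- by apply: measurable_funM => //; exact: measurable_kernel_prob.
- by move=> v; apply: mul01 => //; exact: kernel_prob01.
Qed.

(** Under the law of [A] the factor [K u [0,t]] depends on the first coordinates only, so
    disintegration turns the remaining indicator into [K u [0,s]]. *)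
Lemma Ex_cond_prob_psi s t :
  Ex P (fun w => \1_(response_le s) (Z w) * cond_prob t (X w)) = psi A K s t.
Proof.
have m0s : measurable ([set` `[0, s]] : set R) by [].
have m0t : measurable ([set` `[0, t]] : set R) by [].
have mul01 (a b : R) : 0 <= a <= 1 -> 0 <= b <= 1 -> 0 <= a * b <= 1.
  by move=> /andP[a0 a1] /andP[b0 b1]; rewrite mulr_ge0//= mulr_ile1.
have mks := measurable_kernel_prob K m0s.
have mkt := measurable_kernel_prob K m0t.
transitivity (Ex P (fun w => (fun v => kernel_prob K `[0, t] (init_coords v) *
   \1_[set` `[0, s]] (last_coord v)) (V w))).
  congr Ex; apply/funext => w; rewrite indic_response_le mulrC.
  by rewrite /cond_prob -init_coords_margin_transform.
rewrite (Ex_copula_vector (phi := fun v => kernel_prob K `[0, t] (init_coords v) *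
   \1_[set` `[0, s]] (last_coord v))); last 2 first.
- apply: measurable_funM.
    exact: (measurableT_comp mkt measurable_init_coords).
  exact: (measurableT_comp (measurable_indic m0s) (measurable_coord ord_max)).
- move=> v; apply: mul01; first exact: kernel_prob01.
  by rewrite indicE; case: (_ \in _); rewrite ?lexx ler01.
rewrite (disintegration hK m0s)//; last by move=> u; exact: kernel_prob01.
have mcube : measurable (@unit_cube R d).
  rewrite (_ : unit_cube = \bigcap_(i in [set: 'I_d]) coord i @^-1` [set` `[0, 1]]).
    apply: fin_bigcap_measurable => // i _.
    by rewrite -[Y in measurable Y]setTI; exact: measurable_coord.
  by apply/seteqP; split => u /= h i; [move=> _|]; exact: (h i).
(* [psi] integrates over the cube only; it has full measure because the transformed vector takes its
   values there. *)
have cube1 : {ae init_margin A, forall u, unit_cube u}.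
  exists (~` unit_cube); split; [exact: measurableC| |by []].
  transitivity (P (V @^-1` (init_coords @^-1` (~` unit_cube)))).
    rewrite (copula_vector_law hA)//.
    by rewrite -[Y in measurable Y]setTI; apply: measurable_init_coords => //; exact: measurableC.
  rewrite (_ : _ @^-1` _ = set0) ?measure0//; apply/seteqP; split => w //= h.
  apply: h => i; rewrite coord_init_coords.
  exact: unit_cube_margin_transform.
rewrite /psi Rintegral_mkcond; apply: Ex_ae_eq.
- exact: measurable_funM.
- apply: (measurable_restrictT _ mcube).1; apply: measurable_funTS.
  exact: (measurable_funM mks mkt).
- move: cube1; apply: filterS => u hu; rewrite patchE mem_set// mulrC.
  by [].
Qed.

End conditional_law.

(** * Comparison of the estimator with its limit *)

Section estimator.
Context {R : realType} {d : nat}.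
Variables (z : nat -> d.+1.-tuple R) (u : nat -> R).

Let N n k := nn (fun j => init_coords (z j)) u n k.
Let Y n (k : 'I_n) : R := last_coord (z k).

Definition rank_leY n s k : bool := scaled_ecdf (@Y n) (last_coord (z k)) <= s.

Lemma D_statE n s t : D_stat z u n s t =
  n%:R^-1 * \sum_(k < n) (rank_leY n s k)%:R * (rank_leY n t (N n k))%:R.
Proof.
rewrite /D_stat; congr (_ * _); apply: eq_bigr => k _.
by rewrite !indic_rank_le /rank_le /N -nearest_neighbourE.
Qed.

(* Replacing empirical ranks by the true margin costs as many terms as the two
   lower sets of responses differ by, that is the difference of their sizes. *)
Lemma rank_replacement n s t (g : R -> R) (f : R -> nat -> R) :
  (forall r k, f r k = (g (last_coord (z k)) <= r)%R%:R) ->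
  {homo g : x y / x <= y} ->
  (forall k l, k != l -> last_coord (z k) != last_coord (z l)) ->
  (forall k l, k != l -> init_coords (z k) != init_coords (z l)) ->
  0 <= s <= 1 -> 0 <= t <= 1 ->
  `|\sum_(k < n) (rank_leY n s k)%:R * (rank_leY n t (N n k))%:R -
    \sum_(k < n) f s k * f t (N n k)| <=
  (1 + `|\sum_(k < n) f s k - s * n%:R|) +
  (kissing_bound d).+1%:R * (1 + `|\sum_(k < n) f t k - t * n%:R|).
Proof.
move=> fE gh Yinj Xinj s01 t01.
have bound r : 0 <= r <= 1 ->
    \sum_(k < n) `|(rank_leY n r k)%:R - f r k| <=
    1 + `|\sum_(k < n) f r k - r * n%:R|.
  move=> r01; rewrite !(eq_bigr _ (fun (k : 'I_n) _ => fE r k)).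
  rewrite [X in X <= _](eq_bigr (fun k : 'I_n => `|(rank_leY n r k)%:R -
    (g (last_coord (z k)) <= r)%R%:R|)); last by move=> k _; rewrite fE.
  apply: (@sum_rank_le_symdiff R n (@Y n) (fun k => g (Y k) <= r)) => //.
    by move=> k l kl; apply: Yinj.
  by move=> k l lk; apply: le_trans; exact: gh.
rewrite -sumrB (le_trans (ler_norm_sum _ _ _))//.
(* For values 0 and 1, [|a * a' - b * b'| <= |a - b| + |a' - b'|]. The second sum runs over
   neighbours and is brought back to the sample by [sum_nn_le]. *)
apply: (@le_trans _ _ (\sum_(k < n) `|(rank_leY n s k)%:R - f s k| +
   \sum_(k < n) `|(rank_leY n t (N n k))%:R - f t (N n k)|)).
  rewrite -big_split /=; apply: ler_sum => k _; rewrite !fE.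
  by case: (rank_leY n s k); case: (rank_leY n t _); case: (_ <= s); case: (_ <= t);
    rewrite ?mulr0 ?mulr1 ?mul0r ?mul1r ?subrr ?subr0 ?sub0r ?normrN ?normr0 ?normr1;
    lra.
rewrite lerD ?bound//.
apply: (@le_trans _ _ ((kissing_bound d).+1%:R *
    \sum_(k < n) `|(rank_leY n t k)%:R - f t k|)); last by rewrite ler_wpM2l// bound.
apply: (@sum_nn_le _ _ _ _ _ (fun k => `|(rank_leY n t k)%:R - f t k|)) => //.
by move=> k l _ _; exact: Xinj.
Qed.

End estimator.

Theorem theorem7 (R : realType) (d : nat) (hd : (1 <= d)%N)
  (disp : measure_display) (Omega : measurableType disp)
  (P : probability Omega R)
  (Z : nat -> {RV P >-> d.+1.-tuple R})
  (hZ : iid Z)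
  (hcont : forall i : 'I_d.+1, continuous (margin_cdf (Z 0%N) i))
  (A : copula R d.+1) (hA : connecting_copula (Z 0%N) A)
  (K : R.-pker (d.-tuple R) ~> R) (hK : is_markov_kernel A K)
  (U : nat -> {RV P >-> R})
  (hU : iid U)
  (hU01 : forall B : set R, measurable B ->
     distribution P (U 0%N) B = uniform_prob (@ltr01 R) B)
  (hZU : independent_processes Z U) :
  forall s t : R, 0 <= s <= 1 -> 0 <= t <= 1 ->
    {ae P, forall w, D_stat (fun k => Z k w) (fun k => U k w) n s t
                       @[n --> \oo] --> psi A K s t}.
Proof.
move=> s t s01 t01.
pose G r : set (d.+1.-tuple R) := response_le (Z 0%N) r.
pose h := cond_prob (Z 0%N) K t.
have mG r : measurable (G r) by exact: measurable_response_le.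
have mh : measurable_fun setT h by exact: measurable_cond_prob.
have h01 x : 0 <= h x <= 1 by exact: cond_prob01.
have Ydist := ae_distinct_coord hZ hA ord_max.
have Xdist : {ae P, forall w, forall k l, k != l ->
    init_coords (Z k w) != init_coords (Z l w)}.
  (* [1 <= d] provides a first coordinate; if its values are distinct, so are the vectors. *)
  have := ae_distinct_coord hZ hA (widen_ord (leqnSn d) (Ordinal hd)).
  apply: filterS => w inj k l kl; apply: contra (inj k l kl) => /eqP e.
  by rewrite -!coord_init_coords e.
have ind := iid_indep_pair hZ.
have idn := iid_identical hZ.
have noise0 := ae_smallo_nn_noise hZ hZU (mG s) (mG t) mh h01
  (cond_probP hA hK t) Xdist.
have atoms (i : 'I_d) (b e : R) : 0 < e -> exists p : nat,
    fine (P [set w | `|coord i (init_coords (Z 0%N w)) - b| <= p.+1%:R^-1]) <= e.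
  move=> e0; have [p hp] := margin_no_atom hA b (hcont (widen_ord (leqnSn d) i)) e0.
  exists p; rewrite (le_trans _ hp)// le_eqVlt; apply/orP; left; apply/eqP.
  by congr (fine (P _)); apply/seteqP; split => w /=; rewrite coord_init_coords.
have mis0 := ae_smallo_mismatch (fun k w => U k w) hZ Xdist atoms mh h01.
have mZ k : measurable_fun setT (Z k) by exact: measurable_funPT.
have i01 (T : Type) (C : set T) x : 0 <= (\1_C x : R) <= 1.
  by rewrite indicE; case: (_ \in _); rewrite ?lexx ler01.
have slln_G r : 0 <= r <= 1 -> {ae P, forall w, smallo (fun n =>
    \sum_(k < n) \1_(G r) (Z k w) - n%:R * r)}.
  move=> r01; have := @slln _ _ _ P _ _ (fun k => Z k) mZ ind idn _
    (measurable_indic (mG r)) (fun x => i01 _ (G r) x).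
  rewrite (_ : Ex P _ = r)// -[RHS](prob_response_le hA r01) -Ex_indic//.
  by rewrite -[Y in measurable Y]setTI; exact: mZ.
pose phi z : R := \1_(G s) z * h (init_coords z).
have mphi : measurable_fun setT phi.
  apply: measurable_funM; first exact: measurable_indic.
  exact: (measurableT_comp mh measurable_init_coords).
have phi01 z : 0 <= phi z <= 1.
  have /andP[a0 a1] := i01 _ (G s) z; have /andP[b0 b1] := h01 (init_coords z).
  by rewrite /phi mulr_ge0//= mulr_ile1.
have slln_phi := @slln _ _ _ P _ _ (fun k => Z k) mZ ind idn _ mphi phi01.
have Ephi : Ex P (fun w => phi (Z 0%N w)) = psi A K s t by exact: Ex_cond_prob_psi.
rewrite Ephi in slln_phi.
have hinj : {ae P, forall w,
    (forall k l, k != l -> last_coord (Z k w) != last_coord (Z l w)) /\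
    (forall k l, k != l -> init_coords (Z k w) != init_coords (Z l w))}.
  by move: Ydist Xdist; apply: filterS2 => w.
have hslln : {ae P, forall w, [/\
    smallo (fun n => \sum_(k < n) \1_(G s) (Z k w) - n%:R * s),
    smallo (fun n => \sum_(k < n) \1_(G t) (Z k w) - n%:R * t) &
    smallo (fun n => \sum_(k < n) phi (Z k w) - n%:R * psi A K s t)]}.
  by move: (slln_G s s01) (slln_G t t01) slln_phi; apply: filterS3 => w.
have hnn : {ae P, forall w,
    smallo (nn_noise Z U (G s) (G t) h ^~ w) /\
    smallo (mismatch Z (fun k w => U k w) h ^~ w)}.
  by move: noise0 mis0; apply: filterS2 => w.
move: hinj hslln hnn; apply: filterS3 => w [Yinj Xinj] [w3 w4 w5] [w1 w2].
pose S n : R := \sum_(k < n) (rank_leY (fun k => Z k w) n s k)%:R *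
  (rank_leY (fun k => Z k w) n t (nn (fun j => init_coords (Z j w)) (fun k => U k w) n k))%:R.
have so : smallo (fun n => S n - n%:R * psi A K s t).
  pose c : R := (kissing_bound d).+1%:R.
  (* The errors of rank replacement at [s] and at [t], of the noise, of moving [h] from the
     neighbour to the point, and of the law of large numbers. *)
  pose b n := (1 + `|\sum_(k < n) \1_(G s) (Z k w) - n%:R * s|) +
    c * (1 + `|\sum_(k < n) \1_(G t) (Z k w) - n%:R * t|) +
    `|nn_noise Z U (G s) (G t) h n w| + mismatch Z (fun k w => U k w) h n w +
    `|\sum_(k < n) phi (Z k w) - n%:R * psi A K s t|.
  apply: (@smallo_le _ _ b); last first.
    apply: smalloD; last exact: smallo_norm.
    apply: smalloD; last exact: w2.
    apply: smalloD; last exact: smallo_norm.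
    apply: smalloD; first by apply: smalloD; [exact: smallo_cst|exact: smallo_norm].
    by apply: smalloZ; apply: smalloD; [exact: smallo_cst|exact: smallo_norm].
  move=> n.
  have fE r k : \1_(G r) (Z k w) =
      (margin_cdf (Z 0%N) ord_max (last_coord (Z k w)) <= r)%R%:R :> R.
    by rewrite indicE; congr (_%:R); congr nat_of_bool; apply/idP/idP; rewrite inE.
  have := @rank_replacement _ _ (fun k => Z k w) (fun k => U k w) n s t
    _ (fun r k => \1_(G r) (Z k w)) fE (@margin_cdf_homo _ _ _ _ _ _ _)
    Yinj Xinj s01 t01.
  rewrite -/(S n); set T := \sum_(k < n) _ * _ => ST.
  (* With [N] the neighbour of [k]: [f_k g_N = f_k (g_N - h(X_N)) + f_k (h(X_N) - h(X_k)) + f_k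
     h(X_k)]. *)
  have ET : T - n%:R * psi A K s t = nn_noise Z U (G s) (G t) h n w +
      \sum_(k < n) \1_(G s) (Z k w) *
        (h (init_coords (Z (NN Z U n k w) w)) - h (init_coords (Z k w))) +
      (\sum_(k < n) phi (Z k w) - n%:R * psi A K s t).
    rewrite addrA -!big_split /=; congr (_ - _); apply: eq_bigr => k _.
    by rewrite /noise /phi /NN; ring.
  have mis : `|\sum_(k < n) \1_(G s) (Z k w) *
      (h (init_coords (Z (NN Z U n k w) w)) - h (init_coords (Z k w)))| <=
      mismatch Z (fun k w => U k w) h n w.
    rewrite (le_trans (ler_norm_sum _ _ _))//; apply: ler_sum => k _.
    have /andP[a0 a1] := i01 _ (G s) (Z k w).
    by rewrite normrM (ger0_norm a0) ler_piMl.
  have -> : S n - n%:R * psi A K s t = (S n - T) + (T - n%:R * psi A K s t).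
    by rewrite addrA subrK.
  rewrite ET /b (mulrC n%:R s) (mulrC n%:R t) (le_trans (ler_normD _ _))//.
  have n1 := ler_normD (nn_noise Z U (G s) (G t) h n w) (\sum_(k < n)
    \1_(G s) (Z k w) *
      (h (init_coords (Z (NN Z U n k w) w)) - h (init_coords (Z k w)))).
  rewrite -!(addrA (_ + c * _)) lerD//.
  by rewrite (le_trans (ler_normD _ _))// lerD2r (le_trans n1)// lerD2l.
have := smallo_cvg so => h5.
rewrite -[psi A K s t]add0r.
have : ((S n - n%:R * psi A K s t) / n%:R + psi A K s t) @[n --> \oo] --> 0 + psi A K s t.
  by apply: cvgD => //; exact: cvg_cst.
apply: cvg_trans; apply: near_eq_cvg; near=> n.
rewrite D_statE -/(S n) mulrBl mulrAC divff ?mul1r ?subrK 1?mulrC//.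
by rewrite pnatr_eq0 -lt0n; near: n; exact: nbhs_infty_gt.
Unshelve. all: by end_near.
Qed.
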